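(* Let $k\ge 2$ be an integer. (1) Let $p\equiv 1\pmod k$ be a prime with $p>42^2k^2(3k+8)^2$, and let $D_k=\{x^k : x\in\mathbb{F}_p\setminus\{0\}\}$. Suppose that $A,B\subseteq\mathbb{F}_p$ satisfy $A+B=D_k$ and $|A|,|B|\ge 2$. Then $$\frac{\sqrt{p}}{6k}\le |A|\le 6\sqrt{p}\quad\text{and}\quad \frac{\sqrt{p}}{6k}\le |B|\le 6\sqrt{p}.$$ (2) Moreover, for every $\varepsilon>0$ there is a number $p_0=p_0(k,\varepsilon)$ such that for every prime $p\equiv 1\pmod k$ with $p>p_0$ and all $A,B\subseteq\mathbb{F}_p$ with $A+B=D_k$ and $|A|,|B|\ge 2$, both $|A|$ and $|B|$ lie in the interval $$\left[\left(\frac13-\varepsilon\right)\frac{\sqrt p}{k},\ (3+\varepsilon)\sqrt p\right].$$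
   Context: For a prime $p$, $\mathbb{F}_p$ is the field with $p$ elements. For $A,B\subseteq\mathbb{F}_p$, $A+B=\{a+b: a\in A,\ b\in B\}$, and $|A|$ denotes the cardinality of $A$. For a prime $p\equiv 1\pmod k$, $D_k=\{x^k : x\in\mathbb{F}_p\setminus\{0\}\}$ is the set of nonzero $k$th powers in $\mathbb{F}_p$. *)

(* Defs.v *)
From HB Require Import structures.
From mathcomp Require Export all_boot all_order all_algebra.
From mathcomp Require Export reals.

Set Implicit Arguments.
Unset Strict Implicit.
Unset Printing Implicit Defensive.

Export Order.TTheory GRing.Theory Num.Theory.

Local Open Scope ring_scope.

Definition sumset (V : finZmodType) (A B : {set V}) : {set V} :=
  [set a + b | a in A, b in B].

(* 'F_p has p elements only when p is prime. *)
Definition kth_powers (p k : nat) : {set 'F_p} :=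
  [set x ^+ k | x : 'F_p & x != 0].

(* Main.v *)
Require Import Defs.
From mathcomp Require Import all_fingroup all_solvable all_field qpoly qfpoly.
From mathcomp Require Import zify ring lra.

(* Write N = |A|, m = |B|. The Hanson-Petridis form of Stepanov's method gives
   k N m <= p - 1 as soon as A + B consists of nonzero kth powers, so in a
   decomposition A + B = D_k every sum is represented once and k N m = p - 1.

   For a character chi of order k, f(x) = sum_(b in B) chi(x + b) equals m on A.
   Weil's bound for the correlations of chi along four points gives
     N m^4 <= sum_x |f(x)|^4 <= 3 m^2 p + 3 m^4 sqrt p,
   whence N (m - 3k) <= 3 m sqrt p + 3 / m: this is the theorem when m is large
   compared with k. Small m are impossible: the mixed moment
   sum_x |f(x)|^2 g(x)^2, where g(x) = #{b in B : x + b in D_k}, has a main term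
   smaller than N m^4 by a constant factor, forcing N = O(sqrt p). The mixed
   moment only fails for k = m = 2, where three-point correlations show that A
   and one of its translates intersect.

   Weil's bound is needed only for prod_b chi(x - b)^(E b) with some E b = 1. Its
   L-function is a polynomial of degree < |S| by Lagrange interpolation; its
   logarithmic derivative counts irreducible polynomials P according to the
   value of the product at P, which reciprocity turns into the residue of
   (prod_b (b - X)^(E b))^((q^n - 1)/k) modulo P. For even n, Bombieri's version of
   Stepanov's argument bounds these counts, and the bound q^(n/2) for infinitely
   many n bounds each reciprocal root by sqrt q. *)

Set Implicit Arguments.
Unset Strict Implicit.
Unset Printing Implicit Defensive.

Local Open Scope ring_scope.

(** * Monic polynomials over a finite field *)

Section MonicPolynomials.
Variable F : finFieldType.
Implicit Types (g P : {poly F}) (n d i j : nat).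

(** The decomposition is symmetric in A and B, and k N m = p - 1; so an upper bound for N is also a
    lower bound for m, and only upper bounds are estimated. The constant 3 is the number of ways to
    pair off four shifts. Its doubling to 6 pays for replacing m - 3k by about m/2, and the
    quadratic in k below sqrt p serves mainly to exclude m <= 6k + 1.

    The fourth moment is useless for m < 3k, since its diagonal 3 m^2 p then exceeds N m^4 = m^3 (p
    - 1)/k. In the mixed moment the two sides differ in their main terms by a positive multiple of
    (m - 1)((k - 1)m - 2), which vanishes only for k = m = 2.

    Stepanov's argument bounds each residue class of primes from above only. This suffices because
    all classes together have total degree q^n up to the few primes dividing the product. Even n is
    what splits the exponent (q^n - 1)/k as t (M + 1) with M^2 = q^n.

    Correlations of two characters occur with arbitrary exponents, possibly none equal to 1; they
    are Jacobi sums, handled by an elementary second moment instead. *)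

Definition monics n : seq {poly F} := [seq 'X^n + rVpoly v | v : 'rV[F]_n].

Lemma mem_monics n g : (g \in monics n) = (g \is monic) && (size g == n.+1).
Proof.
apply/imageP/andP => [[v _ ->]|[gmon /eqP gsz]].
  have hs : (size (rVpoly v) < size ('X^n : {poly F}))%N.
    by rewrite size_polyXn ltnS size_poly.
  by rewrite size_polyDl // size_polyXn eqxx monicE lead_coefDl // lead_coefXn.
have hs : (size (g - 'X^n)%R <= n)%N.
  apply/leq_sizeP => j hj; rewrite coefB coefXn.
  move: hj; rewrite leq_eqVlt => /orP[/eqP <-|hj].
    by move/monicP: gmon; rewrite lead_coefE gsz /= => ->; rewrite eqxx subrr.
  by rewrite nth_default ?gsz // gtn_eqF // subr0.
by exists (poly_rV (g - 'X^n)); rewrite // poly_rV_K // subrKC.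
Qed.

Lemma monics_uniq n : uniq (monics n).
Proof.
rewrite /monics /image_mem map_inj_uniq ?enum_uniq //.
by move=> u v /addrI /(can_inj (@rVpolyK _ _)).
Qed.

Lemma size_monics n : size (monics n) = (#|F| ^ n)%N.
Proof. by rewrite size_image card_mx mul1n. Qed.

Lemma monicsW n g : g \in monics n -> (g \is monic) /\ size g = n.+1.
Proof. by rewrite mem_monics => /andP[? /eqP]. Qed.

Definition irr_monics d := [seq P <- monics d | irreducibleb P].

Lemma irr_monicsP d P :
  reflect [/\ irreducible_poly P, P \is monic & size P = d.+1]
          (P \in irr_monics d).
Proof.
rewrite mem_filter mem_monics.
by apply: (iffP and3P) => [[/irreducibleP ? ? /eqP]|[/irreducibleP ? ? ->]].
Qed.

Lemma irr_monics_uniq d : uniq (irr_monics d).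
Proof. by rewrite filter_uniq ?monics_uniq. Qed.

Lemma monic_factor g : g \is monic -> (1 < size g)%N ->
  exists d P h, [/\ P \in irr_monics d, (0 < d)%N, h \is monic & g = P * h].
Proof.
have [n] := ubnP (size g); elim: n g => // n IHn g /ltnSE leg gmon g1.
have [/irreducibleP girr|] := boolP (irreducibleb g).
  exists (size g).-1, g, 1; rewrite mulr1 monic1; split => //.
    by apply/irr_monicsP; split => //; lia.
  by lia.
rewrite /irreducibleb g1 /= negb_forall => /existsP[r].
rewrite negb_imply -ltnNge -Pdiv.Idomain.dvdpE => /andP[rg r1].
have r0 : (r : {poly F}) != 0 by rewrite -size_poly_gt0 (ltn_trans _ r1).
have rsz : (size (r : {poly F}) < n)%N.
  apply: leq_ltn_trans (size_npoly r) _.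
  by rewrite prednK // (ltn_trans _ g1).
set r' := (lead_coef r)^-1 *: (r : {poly F}).
have lr0 : lead_coef r != 0 by rewrite lead_coef_eq0.
have r'mon : r' \is monic by rewrite monicE lead_coefZ mulVf.
have r'sz : size r' = size r by rewrite size_scale ?invr_eq0.
have /dvdpP[s gE] : r' %| g by rewrite dvdpZl ?invr_eq0.
have smon : s \is monic by rewrite -(monicMr _ r'mon) -gE.
have [|//||d [P [h [Pirr d0 hmon r'E]]]] := IHn r'; rewrite ?r'sz //.
exists d, P, (h * s); split; rewrite ?monicMl //.
by rewrite mulrA -r'E mulrC.
Qed.
End MonicPolynomials.

(** * The von Mangoldt identity for polynomials *)

Section Mangoldt.
Variable F : finFieldType.
Implicit Types (g P Q : {poly F}) (n d i j : nat).

Lemma irr_monics_coprime d e P Q :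
  P \in irr_monics F d -> Q \in irr_monics F e -> P != Q -> coprimep P Q.
Proof.
move=> /irr_monicsP[Pirr Pmon _] /irr_monicsP[Qirr Qmon _] PQ.
rewrite irreducible_poly_coprime //; apply/negP => PdQ.
case: Qirr => _ /(_ P); rewrite PdQ => Qmin.
have /Qmin : size P != 1 by case: Pirr; case: size => [|[]].
move=> /(_ isT); rewrite -dvdp_size_eqp // => /eqP sz.
case/negP: PQ; rewrite -eqp_monic //; rewrite -dvdp_size_eqp // sz //.
Qed.

(** For d = deg P and deg g <= [K] this is the multiplicity of [P] in [g]. The cutoff [K] does not
    depend on [g], so that sums over [g] and over powers of [P] can be exchanged. *)
Definition pow_mult K d P g : nat :=
  (\sum_(1 <= i < K.+1 | d * i <= K) dvdp (P ^+ i)%R g)%N.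

Lemma pow_mult1 K d P : P \in irr_monics F d -> pow_mult K d P 1 = 0%N.
Proof.
move=> /irr_monicsP[Pirr Pmon Psz]; rewrite /pow_mult big_nat_cond big1 // => i.
case/andP=> /andP[i0 _] _; rewrite dvdp1.
case: eqP => // sz; have := size_exp P i; rewrite sz Psz /= => /esym/eqP.
rewrite muln_eq0 => /orP[/eqP dE|/eqP iE]; last by rewrite iE in i0.
by case: Pirr; rewrite Psz dE.
Qed.

Lemma pow_mult_mul K d d0 P P0 h :
  P \in irr_monics F d -> P0 \in irr_monics F d0 -> (0 < d0)%N ->
  h \is monic -> (d0 + (size h).-1 <= K)%N ->
  pow_mult K d P (P0 * h) = (pow_mult K d P h + (P == P0))%N.
Proof.
move=> Pi P0i d0gt hmon hK; have [PP0|PP0] := eqVneq P P0; last first.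
  rewrite addn0; apply: eq_bigr => i _; rewrite Gauss_dvdpr //.
  by rewrite coprimep_expl // (irr_monics_coprime Pi P0i).
have /irr_monicsP[P0irr P0m P0sz] := P0i.
have P00 : P0 != 0 by rewrite monic_neq0.
have -> : d = d0 by have /irr_monicsP[_ _] := Pi; rewrite PP0 P0sz => -[->].
rewrite {P Pi}PP0 /pow_mult.
have trunc (f : nat -> nat) :
    (\sum_(1 <= i < K.+1 | d0 * i <= K) f i = \sum_(1 <= i < (K %/ d0).+1) f i)%N.
  rewrite [RHS](@big_nat_widen _ _ _ _ _ K.+1) ?ltnS ?leq_div //.
  by apply: eq_bigl => i; rewrite ltnS leq_divRL // mulnC.
rewrite !trunc; have Kd : (0 < K %/ d0)%N by rewrite divn_gt0 //; lia.
case: (K %/ d0)%N Kd (leq_trunc_div K d0) (ltn_ceil K d0gt) => // I _ IK KI.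
rewrite big_ltn // expr1 dvdp_mulr // big_add1 /=.
under eq_bigr => i _ do rewrite exprS dvdp_mul2l //.
(* The powers dividing [P0 * h] are those dividing [h] shifted by one; the leftover power
   [P0 ^+ I.+1] has degree above deg h and contributes nothing. *)
rewrite [in RHS]big_nat_recr //= addnC; congr (_ + _)%N.
rewrite -[LHS]addn0; congr (_ + _)%N; apply/esym/eqP; rewrite eqb0.
apply/negP => /dvdp_leq; rewrite monic_neq0 // => /(_ isT).
have h0 : (0 < size h)%N by rewrite size_poly_gt0 monic_neq0.
have := size_exp P0 I.+1; rewrite P0sz /= => sz ?.
have : (I.+1 * d0 <= (size h).-1)%N by rewrite mulnC -sz -!subn1 leq_sub2r.
by move: KI; rewrite mulSn; lia.
Qed.

(** Polynomial analogue of log n = sum of Lambda(d) over d | n, the degree replacing the logarithm;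
    irreducible factors are split off one at a time. *)
Lemma mangoldt_identity K g : g \is monic -> ((size g).-1 <= K)%N ->
  (\sum_(1 <= d < K.+1) \sum_(P <- irr_monics F d) d * pow_mult K d P g)%N
    = (size g).-1.
Proof.
have [n] := ubnP (size g); elim: n g => // n IHn g /ltnSE leg gmon gK.
have [g1|g1] := leqP (size g) 1.
  have -> : g = 1.
    have := gmon; rewrite [g]size1_polyC // monicE lead_coefC => /eqP ->.
    by rewrite polyC1.
  rewrite size_poly1 big1 // => d _; rewrite big_seq big1 // => P Pi.
  by rewrite pow_mult1 // muln0.
have [d0 [P0 [h [P0i d0gt hmon gE]]]] := monic_factor gmon g1.
have /irr_monicsP[P0irr P0m P0sz] := P0i.
have gsz : (size g).-1 = (d0 + (size h).-1)%N.
  rewrite gE size_monicM ?monic_neq0 // P0sz.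
  have := hmon; move/monic_neq0; rewrite -size_poly_gt0; lia.
have hs : (size h <= (size h).-1.+1)%N by case: size.
rewrite [RHS]gsz.
have split_sum d : (\sum_(P <- irr_monics F d) d * pow_mult K d P g =
    \sum_(P <- irr_monics F d) d * pow_mult K d P h +
    \sum_(P <- irr_monics F d) d * (P == P0))%N.
  rewrite -big_split; apply: eq_big_seq => P Pi.
  by rewrite gE (pow_mult_mul Pi P0i) // -?gsz // mulnDr.
rewrite (eq_bigr _ (fun d _ => split_sum d)) big_split /= IHn //; [|lia|lia].
rewrite addnC; congr (_ + _)%N.
rewrite (bigD1_seq d0) ?mem_index_iota ?iota_uniq //=; last lia.
rewrite (bigD1_seq P0) ?irr_monics_uniq //= eqxx muln1.
rewrite !big1 ?addn0 // => [d /negP dd0|P /negPf ->]; last by rewrite muln0.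
rewrite big_seq big1 // => P /irr_monicsP[_ _ Psz].
by case: eqP => [PE|]; rewrite ?muln0 //; case: dd0; move: P0sz; rewrite -PE Psz => -[->].
Qed.

End Mangoldt.

(** * The Euler product of an L-polynomial *)

Section EulerProduct.
Variables (F : finFieldType) (C : comNzRingType) (X : {poly F} -> C).
Hypothesis X1 : X 1 = 1.
Hypothesis XM : forall g h : {poly F}, X (g * h) = X g * X h.

(** Coefficient of T^n in the L-series L(T) of [X]. *)
Definition monic_sum n := \sum_(g <- monics F n) X g.

(** Coefficient of T^j in T L'/L, read off from the Euler product. *)
Definition prime_sum j := \sum_(1 <= d < j.+1)
  \sum_(1 <= i < j.+1 | (d * i == j)%N) \sum_(P <- irr_monics F d) X P ^+ i *+ d.

Lemma monic_sum0 : monic_sum 0 = 1.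
Proof.
have : size (monics F 0) = 1%N by rewrite size_monics expn0.
rewrite /monic_sum; case E: (monics F 0) => [|g [|]] // _.
have : g \in monics F 0 by rewrite E mem_seq1.
move=> /monicsW[gmon gsz]; rewrite big_seq1.
have := gmon; rewrite [g]size1_polyC ?gsz // monicE lead_coefC => /eqP ->.
by rewrite polyC1 X1.
Qed.

Lemma multiple_sum n e Q : Q \in monics F e -> (e <= n)%N ->
  \sum_(g <- monics F n | Q %| g) X g = X Q * monic_sum (n - e).
Proof.
move=> /monicsW[Qmon Qsz] en; rewrite -big_filter mulr_sumr.
rewrite -(eq_bigr _ (fun h _ => XM Q h)).
rewrite -(big_map (fun h => Q * h) xpredT X).
have Q0 : Q != 0 by rewrite monic_neq0.
apply: perm_big; apply: uniq_perm.
- by rewrite filter_uniq ?monics_uniq.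
- by rewrite map_inj_uniq ?monics_uniq //; apply: mulfI.
move=> g; rewrite mem_filter mem_monics; apply/and3P/mapP.
  case=> /dvdpP[h gE] gmon /eqP gsz; exists h; last by rewrite mulrC.
  have hmon : h \is monic by rewrite -(monicMl _ Qmon) mulrC -gE.
  rewrite mem_monics hmon /=; move: gsz.
  rewrite gE size_Mmonic ?monic_neq0 // Qsz => sz; apply/eqP.
  have := monic_neq0 hmon; rewrite -size_poly_gt0.
  move: sz; rewrite addnS /=; case: (size h) => // s.
  by rewrite addSn => -[<-]; rewrite addnK.
case=> h /monicsW[hmon hsz] ->; rewrite dvdp_mulr // monicMl //; split => //.
by rewrite size_Mmonic // Qsz hsz; apply/eqP; lia.
Qed.

Lemma exp_irr_monics d P i : P \in irr_monics F d -> P ^+ i \in monics F (d * i).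
Proof.
move=> /irr_monicsP[_ Pmon Psz]; rewrite mem_monics monic_exp //=.
have := size_exp P i; rewrite Psz /= => <-; apply/eqP; rewrite prednK //.
by rewrite size_poly_gt0 monic_neq0 ?monic_exp.
Qed.

Lemma X_exp P i : X (P ^+ i) = X P ^+ i.
Proof. by elim: i => [|i IHi]; rewrite ?expr0 // !exprS XM IHi. Qed.

(** The identity T L' = (T L'/L) L, coefficient by coefficient. In [X g *+ n] the factor n is
    expanded by [mangoldt_identity]; for fixed [P] and i the multiples of [P ^+ i] are then summed
    by [multiple_sum]. *)
Lemma log_derivative n :
  monic_sum n *+ n = \sum_(1 <= j < n.+1) prime_sum j * monic_sum (n - j).
Proof.
transitivity (\sum_(1 <= d < n.+1) \sum_(P <- irr_monics F d)
   \sum_(1 <= i < n.+1 | (d * i <= n)%N) (X P ^+ i * monic_sum (n - d * i)) *+ d).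
  transitivity (\sum_(g <- monics F n) \sum_(1 <= d < n.+1)
     \sum_(P <- irr_monics F d) \sum_(1 <= i < n.+1 | (d * i <= n)%N)
        (if P ^+ i %| g then X g else 0) *+ d).
    rewrite /monic_sum -sumrMnl; apply: eq_big_seq => g /monicsW[gmon gsz].
    have := mangoldt_identity (K := n) gmon; rewrite gsz => /(_ (leqnn n)) /= nE.
    rewrite -[X in _ *+ X = _]nE -sumrMnr.
    apply: eq_bigr => d _; rewrite -sumrMnr; apply: eq_bigr => P _.
    rewrite mulnC mulrnA -sumrMnr -sumrMnl; apply: eq_bigr => i _.
    by case: (P ^+ i %| g).
  rewrite exchange_big; apply: eq_bigr => d _.
  rewrite exchange_big; apply: eq_big_seq => P Pi.
  rewrite exchange_big; apply: eq_bigr => i din.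
  rewrite sumrMnl -big_mkcond /= (multiple_sum (exp_irr_monics i Pi)) //.
  by rewrite X_exp.
transitivity (\sum_(1 <= j < n.+1) \sum_(1 <= d < n.+1)
    \sum_(1 <= i < n.+1 | (d * i == j)%N) \sum_(P <- irr_monics F d)
      (X P ^+ i * monic_sum (n - j)) *+ d).
  rewrite [RHS]exchange_big; apply: eq_big_nat => d /andP[d0 _].
  rewrite exchange_big [RHS](exchange_big_dep xpredT) //= big_mkcond.
  apply: eq_big_nat => i /andP[i0 _].
  rewrite (eq_bigl (pred1 (d * i)%N)) => [|j]; last by rewrite eq_sym.
  by rewrite big_nat1_eq ltnS muln_gt0 d0 i0.
apply: eq_big_nat => j /andP[j0 jn]; rewrite /prime_sum mulr_suml.
rewrite [RHS](big_nat_widen _ _ n.+1) //= [in LHS](bigID (fun d => d < j.+1)%N) /=.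
rewrite [X in _ + X]big_nat_cond [X in _ + X]big1 ?addr0; last first.
  move=> d /andP[/andP[d0 dn] dj]; rewrite big_nat_cond big1 // => i /andP[/andP[i0 _] /eqP dij].
  by move: dj; rewrite ltnS -dij leq_pmulr.
apply: eq_bigr => d dj; rewrite mulr_suml.
rewrite [RHS](big_nat_widen _ _ n.+1) //= big_nat_cond [RHS]big_nat_cond.
apply: eq_big => [i|i _]; last first.
  by rewrite mulr_suml; apply: eq_bigr => P _; rewrite mulrnAl.
case: (boolP (1 <= i < n.+1)%N) => //= /andP[i0 _].
case: eqP => //= dij; move: dj; rewrite -dij ltnS => dj.
have d0 : (0 < d)%N by case: (d) dij j0 => // <-.
by rewrite ltnS leq_pmull.
Qed.
End EulerProduct.

(** * Power sums and the size of the reciprocal roots *)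

(** This is the recursion of [log_derivative] with prime sums replaced by minus the power sums of
    [s]; hence the two agree when the L-series is the polynomial p. *)
Lemma newton_identity (C : comNzRingType) (s : seq C) n :
  let p := \prod_(a <- s) (1 - a *: 'X) in
  p`_n *+ n = - \sum_(1 <= j < n.+1) (\sum_(a <- s) a ^+ j) * p`_(n - j).
Proof.
elim: s n => [|a s IHs] n /=.
  rewrite big_nil big1 => [|j _]; last by rewrite big_nil mul0r.
  by rewrite coef1; case: n => [|n]; rewrite ?mul0rn oppr0 ?mulr0n.
rewrite big_cons; set p := \prod_(b <- s) _ in IHs *.
have coefS m : ((1 - a *: 'X) * p)`_m.+1 = p`_m.+1 - a * p`_m.
  by rewrite mulrBl mul1r coefB -scalerAl coefZ coefXM.
have coef0 : ((1 - a *: 'X) * p)`_0 = p`_0.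
  by rewrite mulrBl mul1r coefB -scalerAl coefZ coefXM mulr0 subr0.
case: n => [|n]; first by rewrite mulr0n big_geq // oppr0.
under eq_bigr do rewrite big_cons mulrDl.
rewrite big_split /= coefS.
have geom : \sum_(1 <= j < n.+2) a ^+ j * ((1 - a *: 'X) * p)`_(n.+1 - j) = a * p`_n.
  (* The sum telescopes; its top index is separated because the constant coefficient has no
     predecessor. *)
  rewrite (eq_big_nat _ _ (F2 := fun j =>
    (if (j <= n)%N then (a ^+ j * p`_(n.+1 - j) - a ^+ j.+1 * p`_(n - j)) else a ^+ n.+1 * p`_0))).
    rewrite big_nat_recr //= ltnn (eq_big_nat _ _ (F2 := fun j =>
      - (a ^+ j.+1 * p`_(n.+1 - j.+1) - a ^+ j * p`_(n.+1 - j)))).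
      by rewrite sumrN telescope_sumr // subnn subn1 expr1 opprB subrK.
    by move=> j /andP[_ jn]; rewrite -ltnS jn subSS opprB.
  move=> j /andP[j1 jn]; case: ifP => jn'; first by rewrite subSn // coefS mulrBr exprSr mulrA.
  have -> : j = n.+1 by lia.
  by rewrite subnn coef0.
rewrite geom mulrnBl IHs.
have -> : \sum_(1 <= j < n.+2) (\sum_(b <- s) b ^+ j) * ((1 - a *: 'X) * p)`_(n.+1 - j)
  = \sum_(1 <= j < n.+2) (\sum_(b <- s) b ^+ j) * p`_(n.+1 - j)
    - a * \sum_(1 <= j < n.+1) (\sum_(b <- s) b ^+ j) * p`_(n - j).
  rewrite big_nat_recr //= [in RHS]big_nat_recr //= subnn coef0 addrAC; congr (_ + _).
  rewrite mulr_sumr -sumrB; apply: eq_big_nat => j /andP[_ jn].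
  by rewrite subSn // coefS mulrBr mulrCA.
set U := \sum_(1 <= j < n.+2) _; set V := \sum_(1 <= j < n.+1) _.
have -> : V = - (p`_n *+ n) by rewrite IHs opprK.
by rewrite -mulr_natr -[in RHS]mulr_natr [in LHS]mulrSr; ring.
Qed.

Lemma bounded_exp_le1 (x K : algC) : 0 <= x -> (forall n, x ^+ n.+1 <= K) -> x <= 1.
Proof.
move=> x0 xK; rewrite real_leNgt ?ger0_real //; apply/negP => x1.
have h0 : 0 < x - 1 by rewrite subr_gt0.
have bern n : 1 + (x - 1) *+ n <= x ^+ n.
  elim: n => [|n IHn]; first by rewrite mulr0n addr0 expr0.
  rewrite exprS; apply: (le_trans _ (ler_wpM2l x0 IHn)).
  rewrite -subr_ge0.
  have -> : x * (1 + (x - 1) *+ n) - (1 + (x - 1) *+ n.+1) = ((x - 1) ^+ 2) *+ n.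
    by rewrite -[x in LHS]/(x) mulrS -mulr_natr -[_ *+ n in RHS]mulr_natr; ring.
  by rewrite mulrn_wge0 // exprn_ge0 // ltW.
have K0 : 0 <= K by apply: le_trans (xK 0); rewrite exprn_ge0.
have := archi_boundP (divr_ge0 K0 (ltW h0)).
set n := Num.bound _; rewrite ltr_pdivrMr // => nK.
have : K < K; last by rewrite ltxx.
apply: lt_le_trans nK (le_trans _ (le_trans (bern n.+1) (xK n))).
by rewrite mulr_natl [(x - 1) *+ n.+1]mulrS addrA lerDr addr_ge0 // ltW.
Qed.

(** Let [Q] vanish at all elements of [s] except a. Combining consecutive power sums with the
    coefficients of [Q] isolates the multiple [Q.[a]] of a^(n+1), so the powers of |a|/r stay
    bounded. *)
Lemma power_sum_growth (s : seq algC) (K r : algC) : 0 < r ->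
  (forall n, `|\sum_(b <- s) b ^+ n.+1| <= K * r ^+ n.+1) ->
  forall a, a \in s -> `|a| <= r.
Proof.
move=> r0 sK a sa.
pose t := [seq b <- undup s | b != a].
pose Q : {poly algC} := \prod_(b <- t) ('X - b%:P).
have Qa : Q.[a] != 0.
  rewrite -[_ == 0]/(root Q a) root_prod_XsubC mem_filter eqxx //.
have Qs b : b \in s -> b != a -> Q.[b] = 0.
  by move=> sb ba; apply/eqP; rewrite -[_ == 0]/(root Q b) root_prod_XsubC mem_filter ba mem_undup.
have Psum n : \sum_(i < size Q) Q`_i * (\sum_(b <- s) b ^+ (n.+1 + i))
    = (a ^+ n.+1 * Q.[a]) *+ count_mem a s.
  under eq_bigr do rewrite mulr_sumr.
  rewrite exchange_big /= -iter_addr_0 -big_const_seq.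
  rewrite [RHS]big_mkcond /=; apply: eq_big_seq => b sb.
  transitivity (b ^+ n.+1 * Q.[b]).
    by rewrite horner_coef mulr_sumr; apply: eq_bigr => i _; rewrite exprD mulrCA.
  by case: eqP => [->//|/eqP ba]; rewrite Qs // mulr0.
have K0 : 0 <= K.
  have := le_trans (normr_ge0 _) (sK 0); by rewrite pmulr_lge0 // exprn_gt0.
pose K1 := \sum_(i < size Q) `|Q`_i| * (K * r ^+ i).
have cnt : 1 <= (count_mem a s)%:R :> algC by rewrite ler1n -has_count has_pred1.
rewrite -[leRHS]mul1r -ler_pdivrMr //.
apply: (@bounded_exp_le1 _ (K1 / `|Q.[a]|)); first by rewrite divr_ge0 // ltW.
move=> n; rewrite expr_div_n ler_pdivrMr ?exprn_gt0 // mulrAC ler_pdivlMr ?normr_gt0 //.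
rewrite -normrX -normrM.
apply: (@le_trans _ _ `|(a ^+ n.+1 * Q.[a]) *+ count_mem a s|).
  by rewrite -mulr_natr [leRHS]normrM normr_nat ler_peMr.
rewrite -Psum mulr_suml; apply: le_trans (ler_norm_sum _ _ _) _.
apply: ler_sum => i _; rewrite normrM -mulrA ler_wpM2l //.
by apply: le_trans (sK (n + i)%N) _; rewrite -addSn exprD -mulrA [r ^+ i * _]mulrC.
Qed.

(** The hypothesis concerns even indices only: these are the power sums of the squares of the
    reciprocal roots, which bounds each square by q. Up to sign, [c 1] is the sum of at most r - 1
    reciprocal roots. *)
Lemma first_coef_bound (c a : nat -> algC) (r : nat) (K q : algC) :
  (0 < r)%N -> 0 < q -> c 0 = 1 -> (forall n, (r <= n)%N -> c n = 0) ->
  (forall n, c n *+ n = \sum_(1 <= j < n.+1) a j * c (n - j)%N) ->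
  (forall n, `|a n.+1.*2| <= K * q ^+ n.+1) ->
  `|c 1| <= sqrtC q *+ r.-1.
Proof.
move=> r0 q0 c0 cr crec aK.
pose p : {poly algC} := \poly_(i < r) c i.
have pc i : p`_i = c i by rewrite coef_poly; case: ltnP => // /cr.
have p0 : p != 0 by apply/eqP => pE; have := pc 0; rewrite pE coef0 c0 => /eqP; rewrite eq_sym oner_eq0.
have [rs pE] := closed_field_poly_normal p.
have p01 : p.[0] = 1 by rewrite horner_coef0 pc.
have rs0 z : z \in rs -> z != 0.
  move=> zrs; apply/eqP => z0; have : root p 0.
    by rewrite pE rootZ ?lead_coef_eq0 // root_prod_XsubC -z0.
  by rewrite /root p01 oner_eq0.
pose s := [seq z^-1 | z <- rs].
have pS : p = \prod_(b <- s) (1 - b *: 'X).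
  have prodE : \prod_(z <- rs) ('X - z%:P) = (\prod_(z <- rs) - z) *: \prod_(b <- s) (1 - b *: 'X).
    rewrite big_map -scaler_prod; apply: eq_big_seq => z /rs0 z0.
    by rewrite scalerBr scalerA mulNr divff // scaleN1r opprK scaleNr alg_polyC addrC.
  rewrite pE prodE scalerA.
  suff -> : lead_coef p * \prod_(z <- rs) - z = 1 by rewrite scale1r.
  apply: etrans p01; rewrite [in RHS]pE hornerZ horner_prod; congr (_ * _).
  by apply: eq_bigr => z _; rewrite hornerXsubC sub0r.
have ssz : (size s <= r.-1)%N.
  rewrite size_map -ltnS prednK //; apply: leq_trans (size_poly r c).
  by rewrite -/p pE size_scale ?lead_coef_eq0 // size_prod_XsubC.
have aE n : a n.+1 = - \sum_(b <- s) b ^+ n.+1.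
  have [m] := ubnP n; elim: m n => // m IHm n /ltnSE nm.
  have := newton_identity s n.+1; rewrite /= -pS pc crec.
  rewrite big_nat_recr //= [in X in _ = X]big_nat_recr //= subnn pc c0 !mulr1 opprD.
  rewrite -sumrN [in X in _ = X](eq_big_nat _ _ (F2 := fun j => a j * c (n.+1 - j)%N)); last first.
    move=> [|j] // /andP[_ jn]; rewrite IHm ?pc ?mulNr //.
    by lia.
  by move/addrI.
rewrite [c 1](_ : _ = a 1%N); last first.
  by have := crec 1%N; rewrite mulr1n big_nat1 subnn c0 mulr1.
have qC0 : 0 <= sqrtC q by rewrite sqrtC_ge0 ltW.
rewrite aE normrN; apply: le_trans (ler_norm_sum _ _ _) _.
apply: (@le_trans _ _ (sqrtC q *+ size s)); last by rewrite ler_wpMn2l.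
rewrite -iter_addr_0 -(count_predT s) -big_const_seq.
rewrite big_seq [leRHS]big_seq; apply: ler_sum => b sb; rewrite expr1.
have b2 : `|b ^+ 2| <= q.
  apply: (@power_sum_growth [seq b ^+ 2 | b <- s] K q) => // [n|]; last exact: map_f.
  rewrite big_map -normrN; apply: le_trans (aK n).
  rewrite doubleS aE -doubleS.
  by under eq_bigr do rewrite -exprM mul2n.
rewrite -(@ler_pXn2r _ 2) ?nnegrE // -normrX sqrtCK //.
Qed.

(** * Frobenius and norms in residue fields *)

Section Frobenius.
Variable F : finFieldType.
Local Notation q := #|F|.

Lemma card_pchar_nat (R : nzRingType) (f : {rmorphism F -> R}) j :
  [pchar R].-nat (q ^ j)%N.
Proof.
have [p p_pr pF] := finPcharP F.
have := abelem_pgroup (fin_ring_pchar_abelem pF); rewrite /pgroup cardsT => qp.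
rewrite pnatX; apply/orP; left; apply: sub_in_pnat qp => r _.
by rewrite inE => /eqP ->; apply: rmorph_pchar pF.
Qed.

Lemma expD_card (R : comNzRingType) (f : {rmorphism F -> R}) j (x y : R) :
  (x + y) ^+ (q ^ j) = x ^+ (q ^ j) + y ^+ (q ^ j).
Proof. by rewrite exprDn_pchar // (card_pchar_nat f). Qed.

Lemma expB_card (R : comNzRingType) (f : {rmorphism F -> R}) j (x y : R) :
  (x - y) ^+ (q ^ j) = x ^+ (q ^ j) - y ^+ (q ^ j).
Proof. by rewrite (expD_card f) exprNn_pchar // (card_pchar_nat f). Qed.

Lemma exp_card_iter j (c : F) : c ^+ (q ^ j) = c.
Proof. by elim: j => [|j IHj]; rewrite ?expr1 // expnSr exprM IHj expf_card. Qed.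

Lemma horner_exp_card (K : comNzRingType) (f : {rmorphism F -> K}) (g : {poly F}) (x : K) j :
  (map_poly f g).[x] ^+ (q ^ j) = (map_poly f g).[x ^+ (q ^ j)].
Proof.
elim/poly_ind: g => [|g c IHg].
  by rewrite rmorph0 !horner0 expr0n expn_eq0 eqn0Ngt (ltn_trans _ (finNzRing_gt1 F)).
rewrite rmorphD rmorphM /= map_polyX map_polyC !hornerMXaddC (expD_card f) exprMn IHg.
by rewrite -rmorphXn exp_card_iter.
Qed.

(** The powers x^(q^j) are roots since Frobenius fixes the coefficients. They are distinct: a
    coincidence makes x, hence every polynomial in x, a root of X^(q^e) - X with 0 < e < d, which
    has too few roots for [K]. *)
Lemma split_conjugates (K : finFieldType) (f : {rmorphism F -> K}) (d : nat)
    (P : {poly F}) (x : K) :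
  #|K| = (q ^ d)%N -> P \is monic -> size P = d.+1 -> root (map_poly f P) x ->
  (forall y, exists g : {poly F}, y = (map_poly f g).[x]) ->
  map_poly f P = \prod_(j < d) ('X - (x ^+ (q ^ j))%:P).
Proof.
move=> cardK Pmon Psz Px gen.
have q1 : (1 < q)%N by apply: finNzRing_gt1.
have inj i j : (i < j)%N -> (j < d)%N -> x ^+ (q ^ i) != x ^+ (q ^ j).
  move=> ij jd; apply/eqP => xij.
  have xe : x ^+ (q ^ (j - i)) = x.
    have := xij; rewrite -{1}(subnK (ltnW ij)) expnD exprM.
    move/eqP; rewrite -subr_eq0 -(expB_card f) expf_eq0 => /andP[_].
    by rewrite subr_eq0 => /eqP <-.
  pose D : {poly K} := 'X^(q ^ (j - i)) - 'X.
  have qe1 : (1 < q ^ (j - i))%N by rewrite -[1%N](expn0 q) ltn_exp2l // subn_gt0.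
  have Dsz : size D = (q ^ (j - i)).+1.
    by rewrite size_polyDl size_polyXn // size_polyN size_polyX ltnS.
  have D0 : D != 0 by rewrite -size_poly_eq0 Dsz.
  have := max_poly_roots D0 (rs := enum K); rewrite enum_uniq -cardE Dsz cardK.
  have -> : all (root D) (enum K).
    apply/allP => y _; have [g ->] := gen y.
    by rewrite /root !hornerE horner_exp_card xe subrr.
  move=> /(_ isT isT); rewrite ltnS leq_exp2l //; lia.
have := @all_roots_prod_XsubC K (map_poly f P) [seq x ^+ (q ^ j) | j <- index_iota 0 d].
rewrite size_map_poly Psz size_map size_iota subn0 => ->; last 1 first.
- rewrite uniq_rootsE map_inj_in_uniq ?iota_uniq // => i j.
  rewrite !mem_index_iota => /andP[_ id] /andP[_ jd] xij.
  by case: (ltngtP i j) => // ij; [have := inj i j ij jd | have := inj j i ij id];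
    rewrite xij eqxx.
- by rewrite lead_coef_map (monicP Pmon) rmorph1 scale1r big_map big_mkord.
- by [].
apply/allP => _ /mapP[j _ ->].
rewrite /root -horner_exp_card; move/eqP: Px => ->.
by rewrite expr0n expn_eq0 eqn0Ngt (ltn_trans _ q1).
Qed.

Section Residue.
Variables (d : nat) (P : {poly F}) (mi : monic_irreducible_poly P).
Hypothesis Psz : size P = d.+1.
Let K : finFieldType := {poly %/ P with mi}.
Let f : {rmorphism F -> K} := qpolyC P.
Let x : K := in_qpoly P 'X.

Lemma residue_eval (g : {poly F}) : (in_qpoly P g : K) = (map_poly f g).[x].
Proof. by rewrite -[in LHS](comp_polyXr g) in_qpoly_comp_horner. Qed.

Lemma residue_eq0 (g : {poly F}) : ((map_poly f g).[x] == 0) = (P %| g).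
Proof.
rewrite -residue_eval; apply/eqP/idP => [/val_eqP /=|Pg].
  by rewrite -Pdiv.IdomainMonic.modpE ?monic_mk_monic // mk_monicE // => /modp_eq0P.
apply/val_eqP; rewrite /= -Pdiv.IdomainMonic.modpE ?monic_mk_monic // mk_monicE //.
Qed.

Lemma residue_card : #|K| = (q ^ d)%N.
Proof. by rewrite card_qfpoly Psz. Qed.

Lemma residue_frobenius (g : {poly F}) e : P %| g ^+ ((q ^ d) ^ e) - g.
Proof.
rewrite -residue_eq0 rmorphB rmorphXn /= hornerD hornerN horner_exp subr_eq0.
by elim: e => [|e IHe]; rewrite ?expr1 // expnS exprM -residue_card expf_card residue_card.
Qed.

(** The left power is the norm of b - x to [F], the product of its conjugates b - x^(q^j), which is
    P(b). This is the reciprocity step: a value of [P] becomes a power residue modulo [P]. *)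
Lemma residue_norm (b : F) :
  P %| (b%:P - 'X) ^+ (\sum_(j < d) q ^ j) - (P.[b])%:P.
Proof.
have Pmon : P \is monic by case: mi.
have conj := @split_conjugates K f d P x residue_card Pmon Psz.
rewrite -residue_eq0 rmorphB rmorphXn rmorphB /= !map_polyC map_polyX /=.
rewrite hornerD hornerN horner_exp !hornerE -horner_map conj; last first.
- by move=> y; exists (y : {poly %/ P}); rewrite -residue_eval; apply/val_inj;
    rewrite /= Pdiv.CommonRing.rmodp_small ?size_mk_monic.
- by rewrite /root residue_eq0.
rewrite horner_prod expr_sum subr_eq0; apply/eqP; apply: eq_bigr => j _.
by rewrite (expB_card f) -rmorphXn exp_card_iter hornerXsubC.
Qed.

End Residue.
End Frobenius.

(** * The Stepanov-Bombieri auxiliary polynomial *)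

Section Stepanov.
Variables (F : finFieldType) (k t nu D : nat) (b0 w : F) (f h : {poly F}).
Local Notation q := #|F|.
Local Notation M := (q ^ nu)%N.
Local Notation J := (t + D)%N.
Let Y : {poly F} := b0%:P - 'X.
Hypothesis k2 : (2 <= k)%N.
Hypothesis t0 : (0 < t)%N.
Hypothesis ME : M = (k * t).+1.
Hypothesis fE : f = Y * h.
Hypothesis hb0 : h.[b0] != 0.
Hypothesis fsz : (size f <= D.+1)%N.

Implicit Type A : 'M[F]_(k * J, t).

Let coef A (s : 'I_(k * J)) : {poly F} := rVpoly (row s A).

(* Modulo an irreducible P with X^(M^2) = X and f^(t(M+1)) = w, the polynomial
   f^(t(k-1)) * aux_poly^M reduces to test_poly, whose degree is small enough for
   the pigeonhole principle to produce coefficients killing it. *)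
Definition test_poly A := \sum_(s < k * J)
  coef A s ^+ M * (w ^+ (s %% k) *: (Y ^+ (s %/ k) * f ^+ (t * (k.-1 - s %% k)))).

Definition aux_poly A := \sum_(s < k * J)
  coef A s * (f ^+ (t * (s %% k)) * Y ^+ (M * (s %/ k))).

Lemma test_polyB A B : test_poly (A - B) = test_poly A - test_poly B.
Proof.
rewrite /test_poly -sumrB; apply: eq_bigr => s _.
by rewrite /coef !linearB /= (expB_card (polyC : {rmorphism F -> {poly F}})) mulrBl.
Qed.

Lemma sizeY : size Y = 2%N.
Proof. by rewrite /Y -opprB size_polyN size_XsubC. Qed.

Lemma size_exp_le (R : idomainType) (p : {poly R}) n m :
  (size p <= n.+1)%N -> (size (p ^+ m) <= (n * m).+1)%N.
Proof.
move=> pn; have [p0|p0] := posnP (size (p ^+ m)); first by rewrite p0.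
rewrite -(prednK p0) ltnS size_exp leq_mul2r; apply/orP; right.
by rewrite -subn1 leq_subLR add1n.
Qed.

Lemma size_mul_le (R : idomainType) (p r : {poly R}) n m :
  (size p <= n.+1)%N -> (size r <= m.+1)%N -> (size (p * r)%R <= (n + m).+1)%N.
Proof.
move=> pn rm; apply: leq_trans (size_polyMleq _ _) _.
by rewrite -subn1 leq_subLR add1n -addnS -addSn leq_add.
Qed.

Lemma size_coef A s : (size (coef A s) <= t.-1.+1)%N.
Proof. by rewrite prednK // size_poly. Qed.

Lemma size_test_poly A :
  (size (test_poly A) <= (t.-1 * M + (J.-1 + D * (t * k.-1))).+1)%N.
Proof.
apply: leq_trans (size_sum _ _ _) _; apply/bigmax_leqP => s _.
apply: size_mul_le; first exact: size_exp_le (size_coef A s).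
apply: leq_trans (size_scale_leq _ _) _; apply: size_mul_le.
  apply: leq_trans (size_exp_le (n := 1) _ _) _; first by rewrite sizeY.
  rewrite mul1n ltnS -ltnS prednK; last lia.
  by rewrite ltn_divLR; [rewrite [(J * k)%N]mulnC ltn_ord | lia].
apply: leq_trans (size_exp_le _ fsz) _.
by rewrite ltnS leq_mul2l leq_mul2l leq_subr !orbT.
Qed.

Lemma test_poly_kernel : exists2 A, A != 0 & test_poly A = 0.
Proof.
pose L := (t.-1 * M + (J.-1 + D * (t * k.-1))).+1.
pose g A : 'rV[F]_L := poly_rV (test_poly A).
(* There are k J t unknowns for [L] coefficients, and M = k t + 1 gives k J t - L = (k - 2) t + D (t
   - 1) + 1 > 0. *)
have ng : ~ injective g.
  move/leq_card; rewrite !card_mx mul1n leq_exp2l ?finNzRing_gt1 //.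
  rewrite /L ME; apply/negP; rewrite -ltnNge; clear -k2 t0.
  case: t t0 => // u _ /=; case: k k2 => // -[|l] // _ /=; nia.
have [A [B [AB gAB]]] : exists A B, A != B /\ g A = g B.
  case: (boolP [exists A, [exists B, (A != B) && (g A == g B)]]).
    by case/existsP=> A /existsP[B /andP[AB /eqP gAB]]; exists A, B.
  rewrite negb_exists => /forallP ninj; case: ng => A B gAB.
  have := ninj A; rewrite negb_exists => /forallP/(_ B).
  by rewrite gAB eqxx andbT negbK => /eqP.
exists (A - B); first by rewrite subr_eq0.
rewrite test_polyB -[test_poly A](@poly_rV_K _ L) ?size_test_poly //.
by rewrite -/(g A) gAB poly_rV_K ?subrr ?size_test_poly.
Qed.

(* The s-th term of aux_poly vanishes at b0 to order t s + s / k plus the order of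
   the coefficient, which is less than t: the first nonzero term cannot cancel. *)
Lemma aux_poly_neq0 A : A != 0 -> aux_poly A != 0.
Proof.
move=> A0; have [s1 as1] : exists s, coef A s != 0.
  apply/existsP; apply: contraNT A0; rewrite negb_exists => /forallP aA.
  apply/eqP/row_matrixP => s; rewrite row0; apply/(can_inj (@rVpolyK _ _)).
  by rewrite linear0; have := aA s; rewrite negbK => /eqP.
case: (@arg_minnP _ s1 (fun s => coef A s != 0) (fun s => s : nat) as1) => s as0 smin.
set u := (s %% k)%N; set j := (s %/ k)%N.
have termE (r : 'I_(k * J)) : f ^+ (t * (r %% k)) * Y ^+ (M * (r %/ k)) =
    h ^+ (t * (r %% k)) * Y ^+ (t * r + r %/ k).
  rewrite fE exprMn mulrAC mulrC -exprD; congr (_ * _ ^+ _).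
  by rewrite ME {3}(divn_eq r k); lia.
apply/eqP => /eqP; rewrite /aux_poly (bigD1 s) //= addr_eq0 => /eqP sE.
have Yt : Y ^+ (t * s + j + t) %| coef A s * (f ^+ (t * u) * Y ^+ (M * j)).
  rewrite sE dvdpNr; apply: (big_ind (fun p => Y ^+ (t * s + j + t) %| p)) => [|p r|r rs].
  - exact: dvdp0.
  - exact: dvdp_add.
  have [->|ar] := eqVneq (coef A r) 0; first by rewrite mul0r dvdp0.
  rewrite termE mulrA dvdp_mull // dvdp_exp2l //.
  have sr : (s < r)%N by rewrite ltn_neqAle smin // andbT eq_sym.
  rewrite addnAC leq_add //; last by rewrite leq_div2r // ltnW.
  by rewrite -mulnSr leq_mul2l sr orbT.
move: Yt; rewrite termE -/u -/j mulrA addnC exprD dvdp_mul2r; last first.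
  by rewrite expf_neq0 // -size_poly_gt0 sizeY.
rewrite Gauss_dvdpl; last first.
  apply/coprimep_expl/coprimep_expr.
  rewrite /Y -opprB -scaleN1r coprimepZl ?oppr_eq0 ?oner_eq0 // coprimep_sym.
  by rewrite coprimep_XsubC.
move/dvdp_leq => /(_ as0); rewrite leqNgt => /negP; apply.
have -> : size (Y ^+ t) = t.+1.
  have := size_exp Y t; rewrite sizeY mul1n => yt; rewrite -[in RHS]yt prednK //.
  by rewrite size_poly_gt0 expf_neq0 // -size_poly_gt0 sizeY.
by rewrite ltnS /coef size_poly.
Qed.

Lemma size_aux_poly A : (size (aux_poly A) <= (t.-1 + (D * (t * k.-1) + M * J.-1)).+1)%N.
Proof.
apply: leq_trans (size_sum _ _ _) _; apply/bigmax_leqP => s _.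
apply: size_mul_le (size_coef A s) _; apply: size_mul_le.
  apply: leq_trans (size_exp_le _ fsz) _.
  rewrite ltnS !leq_mul2l -ltnS prednK; last lia.
  by rewrite ltn_mod; lia.
apply: leq_trans (size_exp_le (n := 1) _ _) _; first by rewrite sizeY.
rewrite mul1n ltnS leq_mul2l -ltnS prednK; last lia.
by rewrite ltn_divLR; [rewrite [(J * k)%N]mulnC ltn_ord orbT | lia].
Qed.

Lemma aux_poly_dvd A P : irreducible_poly P -> ~~ (P %| f) ->
  P %| Y ^+ (M * M) - Y -> P %| f ^+ (t * M.+1) - w%:P ->
  test_poly A = 0 -> P %| aux_poly A.
Proof.
move=> Pirr Pf PY Pw testA.
have modX (a b : {poly F}) n : P %| a - b -> P %| a ^+ n - b ^+ n.
  by move=> ab; rewrite subrXX dvdp_mulr.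
have modM (a b c d : {poly F}) : P %| a - b -> P %| c - d -> P %| a * c - b * d.
  move=> ab cd; have -> : a * c - b * d = (a - b) * c + b * (c - d) by ring.
  by apply: dvdp_add; [exact: dvdp_mulr | exact: dvdp_mull].
have PX (a : {poly F}) n : ~~ (P %| a) -> ~~ (P %| a ^+ n).
  move=> Pa; rewrite -irreducible_poly_coprime //; apply: coprimep_expr.
  by rewrite irreducible_poly_coprime.
have auxM : P %| f ^+ (t * k.-1) * aux_poly A ^+ M - test_poly A.
  rewrite /aux_poly (big_morph (fun p : {poly F} => p ^+ M) (id1 := 0) (op1 := +%R)).
  - rewrite mulr_sumr /test_poly -sumrB.
    apply: (big_ind (fun p => P %| p)) => [|p r|s _]; [exact: dvdp0|exact: dvdp_add|].
    set u := (s %% k)%N; set j := (s %/ k)%N; set a := coef A s.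
    have uk : (u <= k.-1)%N by rewrite -ltnS prednK ?ltn_mod; lia.
    (* The prefactor supplies the f^(t u) that completes f^(t u M) to f^(t (M+1) u), which is w^u
       modulo [P]; the rest f^(t (k-1-u)) stays. *)
    have -> : f ^+ (t * k.-1) * (a * (f ^+ (t * u) * Y ^+ (M * j))) ^+ M -
      a ^+ M * (w ^+ u *: (Y ^+ j * f ^+ (t * (k.-1 - u)))) =
      a ^+ M * f ^+ (t * (k.-1 - u)) *
        ((f ^+ (t * M.+1)) ^+ u * (Y ^+ (M * M)) ^+ j - (w%:P) ^+ u * Y ^+ j).
      rewrite -{1}(subnK uk) mulnDr exprD -mul_polyC polyC_exp !exprMn -!exprM.
      have -> : (t * M.+1 * u = t * u + t * u * M)%N by lia.
      have -> : (M * j * M = M * M * j)%N by lia.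
      by rewrite exprD; ring.
    by rewrite dvdp_mull // modM // modX.
  - by move=> x y; rewrite (expD_card (polyC : {rmorphism F -> {poly F}})).
  - by rewrite expr0n ME.
have : P %| f ^+ (t * k.-1) * aux_poly A ^+ M by move: auxM; rewrite testA subr0.
rewrite Gauss_dvdpr; last by rewrite irreducible_poly_coprime // PX.
by apply: contraTT; apply: PX.
Qed.

End Stepanov.

(** Distinct monic irreducibles are coprime, so their product divides [G]. This converts the degree
    of the auxiliary polynomial into a weighted count of primes. *)
Lemma sum_degrees_le (F : finFieldType) (s : seq {poly F}) (G : {poly F}) :
  uniq s -> (forall P, P \in s -> exists d, P \in irr_monics F d) ->
  G != 0 -> (forall P, P \in s -> P %| G) ->
  (\sum_(P <- s) (size P).-1 <= (size G).-1)%N.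
Proof.
move=> us irr G0 sG.
have dvdG : \prod_(P <- s) P %| G.
  elim: s us irr sG => [|P s IHs] /=; first by rewrite big_nil dvd1p.
  case/andP=> Ps us irr sG; rewrite big_cons Gauss_dvdp.
    rewrite sG ?mem_head //=; apply: IHs => // Q Qs; [apply: irr|apply: sG];
      by rewrite in_cons Qs orbT.
  rewrite big_seq; apply: (big_ind (fun p => coprimep P p)) => [|p r|Q Qs].
  - exact: coprimep1.
  - by rewrite coprimepMr => -> ->.
  have [d Pd] := irr P (mem_head _ _).
  have [e Qe] : exists e, Q \in irr_monics F e by apply: irr; rewrite in_cons Qs orbT.
  by apply: irr_monics_coprime Pd Qe _; apply: contraNneq Ps => ->.
have smon P : P \in s -> P \is monic.
  by move=> Ps; have [d /irr_monicsP[]] := irr P Ps.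
have -> : (\sum_(P <- s) (size P).-1 = (size (\prod_(P <- s) P)%R).-1)%N.
  elim: s smon {us irr sG dvdG} => [|P s IHs] smon; first by rewrite !big_nil size_poly1.
  have smon' Q : Q \in s -> Q \is monic by move=> Qs; rewrite smon // in_cons Qs orbT.
  have prodmon : \prod_(Q <- s) Q \is monic by rewrite big_seq monic_prod.
  have Pmon : P \is monic by rewrite smon ?mem_head.
  rewrite !big_cons IHs // size_Mmonic ?monic_neq0 //.
  move: (monic_neq0 prodmon) (monic_neq0 Pmon); rewrite -!size_poly_gt0.
  by case: (size P) => // m; case: (size _) => // n _ _; rewrite addSn addnS.
by rewrite -!subn1 leq_sub2r // dvdp_leq.
Qed.

(** * Power residue characters *)

Section PrimeList.
Variable F : finFieldType.
Local Notation q := #|F|.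

Definition prime_list n : seq {poly F} :=
  flatten [seq irr_monics F d | d <- index_iota 1 n.+1 & (d %| n)%N].

Lemma prime_listP n P : (0 < n)%N ->
  reflect (exists2 d, (d %| n)%N & P \in irr_monics F d) (P \in prime_list n).
Proof.
move=> n0; apply: (iffP flatten_mapP) => [[d]|[d dn Pd]].
  by rewrite mem_filter => /andP[dn _] Pd; exists d.
exists d => //; rewrite mem_filter dn mem_index_iota ltnS (dvdn_leq n0 dn).
by rewrite (dvdn_gt0 n0 dn).
Qed.

Lemma prime_list_uniq n : uniq (prime_list n).
Proof.
rewrite /prime_list; set ds := filter _ _.
have : uniq ds by rewrite filter_uniq ?iota_uniq.
elim: ds => //= d ds IHds /andP[dds uds].
rewrite cat_uniq irr_monics_uniq IHds // andbT; apply/hasPn => P /flatten_mapP[e eds].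
move=> /irr_monicsP[_ _ Pe]; apply: contra dds => /irr_monicsP[_ _].
by rewrite Pe => -[<-].
Qed.

Lemma prime_sumE (C : comNzRingType) (X : {poly F} -> C) n : (0 < n)%N ->
  prime_sum X n =
    \sum_(P <- prime_list n) X P ^+ (n %/ (size P).-1) *+ (size P).-1.
Proof.
move=> n0; rewrite /prime_sum /prime_list big_flatten /= big_map big_filter.
rewrite [RHS]big_mkcond /=; apply: eq_big_nat => d /andP[d0 dn].
case: ifP => [dvd_dn|ndvd]; last first.
  rewrite big1 // => i /eqP dE; case/negP: (negbT ndvd).
  by rewrite -dE dvdn_mulr.
rewrite (eq_bigl (pred1 (n %/ d)%N)) => [|i /=]; last first.
  by rewrite eqn_div // mulnC.
rewrite big_nat1_eq ltnS leq_div divn_gt0 // -ltnS dn /=.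
by apply: eq_big_seq => P /irr_monicsP[_ _ ->].
Qed.

(** Take [X] = 1 in [log_derivative]: the left side is n q^n, and by induction each of the first n -
    1 terms on the right is q^n, which leaves q^n for the last. *)
Lemma sum_prime_list n : (0 < n)%N ->
  (\sum_(P <- prime_list n) (size P).-1 = q ^ n)%N.
Proof.
move=> n0; suff : prime_sum (fun _ : {poly F} => 1 : int) n = (q ^ n)%:R.
  rewrite prime_sumE //= (eq_bigr (fun P : {poly F} => (size P).-1%:R)) => [|P _]; last first.
    by rewrite expr1n.
  by rewrite -natr_sum => /eqP; rewrite eqr_nat => /eqP.
have csum m : monic_sum (fun _ : {poly F} => 1 : int) m = (q ^ m)%:R.
  by rewrite /monic_sum big_const_seq count_predT iter_addr_0 size_monics.
have [m] := ubnP n; elim: m n n0 => // m IHm n n0 /ltnSE nm.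
have := @log_derivative F int (fun _ => 1) erefl (fun _ _ => erefl) n.
rewrite csum big_nat_recr //= subnn csum mulr1.
rewrite (eq_big_nat _ _ (F2 := fun=> (q ^ n)%:R)); last first.
  move=> j /andP[j1 jn]; rewrite IHm ?csum ?(leq_trans jn) //.
  by rewrite -natrM -expnD subnKC // ltnW.
rewrite sumr_const_nat subn1 -[X in _ *+ X = _](prednK n0) mulrSr => /addrI //.
Qed.
End PrimeList.

Section Character.
Variables (F : finFieldType) (k : nat) (chi : F -> algC).
Local Notation q := #|F|.

(** For k dividing q - 1 the last field fixes the kernel of [chi] as the kernel of x^((q-1)/k), so
    [chi] has order exactly k. It is also the link with Stepanov's argument, which sees only such
    powers. *)
Record power_char : Prop := PowerChar {
  pchi0 : chi 0 = 0;
  pchi1 : chi 1 = 1;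
  pchiM : forall x y, chi (x * y) = chi x * chi y;
  pchiE : forall x, x != 0 -> (chi x == 1) = (x ^+ (q.-1 %/ k) == 1)
}.

Hypotheses (k2 : (2 <= k)%N) (kq : (k %| q.-1)%N) (chiP : power_char).

Lemma chi_exp x n : chi (x ^+ n) = chi x ^+ n.
Proof. by elim: n => [|n IHn]; rewrite ?expr0 ?pchi1 // !exprS pchiM // IHn. Qed.

Lemma chi_prod (I : Type) (r : seq I) (P : pred I) (f : I -> F) :
  chi (\prod_(i <- r | P i) f i) = \prod_(i <- r | P i) chi (f i).
Proof. by apply: (big_morph chi); [exact: pchiM | exact: pchi1]. Qed.

Lemma chi_neq0 x : (chi x != 0) = (x != 0).
Proof.
have [->|x0] := eqVneq x 0; first by rewrite pchi0 ?eqxx.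
apply/eqP => c0; have := pchi1 chiP.
by rewrite -(divff x0) pchiM // c0 mul0r => /eqP; rewrite eq_sym oner_eq0.
Qed.

Lemma expf_pred_card (x : F) : x != 0 -> x ^+ q.-1 = 1.
Proof.
move=> x0; apply: (mulfI x0).
by rewrite mulr1 -exprS prednK ?expf_card // (ltn_trans _ (finNzRing_gt1 F)).
Qed.

Lemma chi_unity x : x != 0 -> chi x ^+ k = 1.
Proof.
move=> x0; rewrite -chi_exp; apply/eqP; rewrite pchiE ?expf_neq0 //.
by rewrite -exprM mulnC divnK // expf_pred_card.
Qed.

Lemma chi_norm x : x != 0 -> `|chi x| = 1.
Proof.
move=> x0; have := congr1 Num.norm (chi_unity x0); rewrite normrX normr1.
by move/eqP; rewrite pexpr_eq1 ?(ltnW k2) // => /eqP.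
Qed.

Lemma chi_eq x y : x != 0 -> y != 0 -> chi x = chi y ->
  x ^+ (q.-1 %/ k) = y ^+ (q.-1 %/ k).
Proof.
move=> x0 y0 xy; have xy0 : x / y != 0 by rewrite mulf_neq0 ?invr_eq0.
have : chi (x / y) == 1.
  have := pchiM chiP (x / y) y; rewrite divfK // xy.
  by move/eqP; rewrite -[X in X == _]mul1r (inj_eq (mulIf _)) ?chi_neq0 // eq_sym.
rewrite pchiE // expr_div_n => /eqP xyn.
by rewrite -[RHS]mul1r -xyn divfK // expf_neq0.
Qed.

(** Otherwise X^m - 1 with m = e (q-1)/k < q - 1 would vanish at all nonzero elements. *)
Lemma chi_nontrivial e : (0 < e < k)%N -> exists2 c, c != 0 & chi c ^+ e != 1.
Proof.
case/andP=> e0 ek; have q10 : (0 < q.-1)%N by rewrite -subn1 subn_gt0 finNzRing_gt1.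
pose m := (e * (q.-1 %/ k))%N.
have qk0 : (0 < q.-1 %/ k)%N by rewrite divn_gt0 ?(ltnW k2) // (dvdn_leq q10 kq).
have mq : (m < q.-1)%N by rewrite /m -[ltnRHS](divnK kq) [ltnRHS]mulnC ltn_pmul2r.
have m0 : (0 < m)%N by rewrite muln_gt0 e0.
pose G : {poly F} := 'X^m - 1.
have [c c0 cm] : exists2 c, c != 0 & ~~ root G c.
  case: (pickP (fun c => (c != 0) && ~~ root G c)) => [c /andP[]|rG]; first by exists c.
  have Gsz : size G = m.+1 by rewrite size_XnsubC.
  have G0 : G != 0 by rewrite -size_poly_eq0 Gsz.
  have := max_poly_roots G0 (rs := enum (predC1 (0 : F))).
  rewrite enum_uniq -cardE Gsz ltnS cardC1 leqNgt mq => imp.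
  suff : all (root G) (enum (predC1 (0 : F))) by move/imp => /(_ isT).
  apply/allP => c; rewrite mem_enum inE => c0.
  by have := rG c; rewrite c0 => /negbFE.
exists c => //; rewrite -chi_exp pchiE ?expf_neq0 //; apply: contra cm.
by rewrite -exprM -/m /root !hornerE subr_eq0.
Qed.
End Character.

Lemma exists_power_char (F : finFieldType) (k : nat) : (0 < k)%N -> (k %| #|F|.-1)%N ->
  exists2 chi : F -> algC, power_char k chi &
    forall x, chi x == 1 <-> exists2 y, y != 0 & x = y ^+ k.
Proof.
move=> k0 kq; set n := #|F|.-1 in kq *.
have n0 : (0 < n)%N by rewrite /n -subn1 subn_gt0 finNzRing_gt1.
have [g gprim] : exists g : F, n.-primitive_root g.
  have := @has_prim_root F n (enum (predC1 (0 : F))) n0.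
  have -> : all n.-unity_root (enum (predC1 (0 : F))).
    apply/allP => x; rewrite mem_enum inE => x0.
    by rewrite unity_rootE; apply/eqP/expf_pred_card.
  rewrite enum_uniq -cardE cardC1 leqnn => /(_ isT isT isT) /hasP[g _ gp].
  by exists g.
have [z zprim] := C_prim_root_exists k0.
have logP (x : F) : x != 0 -> {i : 'I_n | x = g ^+ i}.
  by move=> /expf_pred_card /(prim_rootP gprim).
(* Only x = 0 has no logarithm to base [g], so the default value is the required [chi 0 = 0]. *)
pose chi (x : F) : algC := if [pick i : 'I_n | x == g ^+ i] is Some i then z ^+ i else 0.
have gX0 i : g ^+ i != 0 by rewrite expf_neq0 // (prim_root_eq0 gprim) -lt0n.
have chi0 : chi 0 = 0.
  by rewrite /chi; case: pickP => // i; rewrite eq_sym (negPf (gX0 i)).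
have chiX i : chi (g ^+ i) = z ^+ i.
  rewrite /chi; case: pickP => [j|/(_ (Ordinal (ltn_pmod i n0)))] /=; last first.
    by rewrite (eq_prim_root_expr gprim) modn_mod eqxx.
  rewrite (eq_prim_root_expr gprim) => /eqP ij; apply/esym/eqP.
  by rewrite (eq_prim_root_expr zprim) -(modn_dvdm i kq) ij modn_dvdm.
have nk : (k * (n %/ k) = n)%N by rewrite mulnC divnK.
have nk0 : (0 < n %/ k)%N by rewrite divn_gt0 // dvdn_leq.
exists chi; first split => //.
- by rewrite -(expr0 g) chiX.
- move=> x y; have [->|x0] := eqVneq x 0; first by rewrite mul0r chi0 mul0r.
  have [->|y0] := eqVneq y 0; first by rewrite mulr0 chi0 mulr0.
  by have [[i ->] [j ->]] := (logP x x0, logP y y0); rewrite -exprD !chiX exprD.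
- move=> x /logP[i ->]; rewrite chiX -exprM -(prim_order_dvd zprim) -(prim_order_dvd gprim).
  have -> : (n %| i * (n %/ k) = (k * (n %/ k) %| i * (n %/ k)))%N by rewrite nk.
  by rewrite dvdn_pmul2r.
move=> x; have [->|x0] := eqVneq x 0.
  rewrite chi0 eq_sym oner_eq0; split=> // -[y y0 /eqP].
  by rewrite eq_sym expf_eq0 (negPf y0) andbF.
have [i xE] := logP x x0; rewrite xE chiX -(prim_order_dvd zprim).
split=> [/dvdnP[j ->]|[y y0]].
  by exists (g ^+ j); rewrite // -exprM.
have [j ->] := logP y y0; rewrite -exprM => /eqP.
rewrite (eq_prim_root_expr gprim) => /eqP ij.
by rewrite /dvdn -(modn_dvdm i kq) ij modn_dvdm // modnMl.
Qed.

(** * Weil's bound for products of shifted characters *)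

Section Weil.
Variables (F : finFieldType) (k : nat) (chi : F -> algC).
Local Notation q := #|F|.
Hypotheses (k2 : (2 <= k)%N) (kq : (k %| q.-1)%N) (chiP : power_char k chi).
Variables (b0 : F) (S' : seq F) (E : F -> nat).
Let S := b0 :: S'.
Hypotheses (Suniq : uniq S) (Eb0 : E b0 = 1%N).

Let val g : F := \prod_(b <- S) g.[b] ^+ E b.
Let X (g : {poly F}) : algC := chi (val g).

Let XM g h : X (g * h) = X g * X h.
Proof.
rewrite /X -(pchiM chiP); congr chi; rewrite /val -big_split.
by apply: eq_bigr => b _; rewrite hornerM exprMn.
Qed.

Let X1 : X 1 = 1.
Proof.
rewrite /X /val big1 ?(pchi1 chiP) // => b _.
by rewrite hornerC expr1n.
Qed.

Let b0S' : b0 \notin S'.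
Proof. by have := Suniq; rewrite /= => /andP[]. Qed.

(** Adding a multiple of G, which vanishes on [S'], multiplies g(b0) by c and keeps the other
    values; as deg G < n this permutes the monics of degree n. Since [E b0 = 1], the sum is
    multiplied by chi(c) != 1. *)
Lemma monic_sum_eq0 n : (size S <= n)%N -> monic_sum X n = 0.
Proof.
move=> Sn; have [c c0] := chi_nontrivial k2 kq chiP (e := 1) k2; rewrite expr1 => chic.
pose G : {poly F} := \prod_(b <- S') ('X - b%:P).
have Gb0 : G.[b0] != 0.
  by rewrite -[_ == 0]/(root G b0) root_prod_XsubC.
have Gb b : b \in S' -> G.[b] = 0.
  by move=> bS; apply/eqP; rewrite -[_ == 0]/(root G b) root_prod_XsubC.
pose phi (g : {poly F}) := g + ((c - 1) * g.[b0] / G.[b0]) *: G.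
have phi0 g : (phi g).[b0] = c * g.[b0].
  by rewrite hornerD hornerZ divfK //; ring.
have phib g b : b \in S' -> (phi g).[b] = g.[b].
  by move=> /Gb Gb0'; rewrite hornerD hornerZ Gb0' mulr0 addr0.
have Gsz (a : F) : (size (a *: G) <= n)%N.
  by apply: leq_trans (size_scale_leq _ _) _; rewrite size_prod_XsubC.
have phi_mon g : g \in monics F n -> phi g \in monics F n.
  move=> /monicsW[gmon gsz].
  have lt : (size (((c - 1) * g.[b0] / G.[b0]) *: G) < size g)%N by rewrite gsz ltnS Gsz.
  rewrite mem_monics /phi; apply/andP; split; last by rewrite size_polyDl // gsz.
  by rewrite monicE lead_coefDl.
have phi_inj : injective phi.
  move=> g g' gg; have /(mulfI c0) b0E : c * g.[b0] = c * g'.[b0] by rewrite -!phi0 gg.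
  by move: gg; rewrite /phi b0E => /addIr.
have XE g : X (phi g) = chi c * X g.
  rewrite /X -(pchiM chiP); congr chi.
  rewrite /val !big_cons phi0 Eb0 !expr1 mulrA; congr (_ * _).
  by apply: eq_big_seq => b /phib ->.
have perm : perm_eq (monics F n) (map phi (monics F n)).
  have um : uniq (map phi (monics F n)) by rewrite map_inj_uniq ?monics_uniq.
  have sub : {subset map phi (monics F n) <= monics F n}.
    by move=> _ /mapP[h hm ->]; apply: phi_mon.
  have [|_ memE] := uniq_min_size um sub; first by rewrite [leqRHS]size_map.
  by apply: uniq_perm; rewrite ?monics_uniq // => g; rewrite memE.
have : monic_sum X n = chi c * monic_sum X n.
  rewrite {1}/monic_sum (perm_big _ perm) big_map mulr_sumr.
  by apply: eq_bigr => g _; rewrite XE.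
move/eqP; rewrite -{1}[monic_sum X n]mul1r -subr_eq0 -mulrBl mulf_eq0 subr_eq0 eq_sym.
by rewrite (negPf chic) => /eqP.
Qed.

Lemma monic_sum1 : monic_sum X 1 = \sum_a \prod_(b <- S) chi (b - a) ^+ E b.
Proof.
have perm : perm_eq (monics F 1) [seq 'X - a%:P | a <- enum F].
  apply: uniq_perm; rewrite ?monics_uniq //.
    by rewrite map_inj_uniq ?enum_uniq // => a b /addrI/oppr_inj/polyC_inj.
  move=> g; rewrite mem_monics; apply/andP/mapP => [[gmon /eqP gsz]|[a _ ->]].
    exists (- g`_0); rewrite ?mem_enum // polyCN opprK.
    apply/polyP => i; rewrite coefD coefX coefC.
    case: i => [|[|i]] /=; rewrite ?add0r ?addr0 //; last by rewrite nth_default ?gsz.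
    by move/monicP: gmon; rewrite lead_coefE gsz.
  by rewrite monicXsubC size_XsubC.
rewrite /monic_sum (perm_big _ perm) big_map big_enum; apply: eq_bigr => a _.
rewrite /X /val (chi_prod chiP); apply: eq_bigr => b _.
by rewrite (chi_exp chiP) hornerXsubC.
Qed.

Let f : {poly F} := \prod_(b <- S) (b%:P - 'X) ^+ E b.
Let D := (\sum_(b <- S) E b)%N.

Lemma irr_dvd_linear d P b : P \in irr_monics F d -> P %| b%:P - 'X -> P.[b] = 0.
Proof.
move=> /irr_monicsP[Pirr Pmon Psz] Pb.
have : P %| 'X - b%:P by rewrite -opprB dvdpNr.
rewrite -[X in _ %| X]expr1 => /dvdp_exp_XsubCP[e e1].
case: e e1 => [_|[|//] _].
  rewrite expr0 => /eqp_size; rewrite size_poly1 => P1.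
  by case: Pirr; rewrite P1.
by rewrite expr1 => /eqp_root -/(_ b); rewrite root_XsubC eqxx => /eqP.
Qed.

Lemma val_neq0 d P : P \in irr_monics F d -> val P != 0 -> ~~ (P %| f).
Proof.
move=> Pd vP; have /irr_monicsP[Pirr Pmon Psz] := Pd.
rewrite -irreducible_poly_coprime //.
rewrite /f big_seq; apply: (big_ind (coprimep P)) => [|p r|b bS].
- exact: coprimep1.
- by rewrite coprimepMr => -> ->.
case: (posnP (E b)) => [->|Eb]; first by rewrite expr0 coprimep1.
apply: coprimep_expr; rewrite irreducible_poly_coprime //.
apply: contra vP => /(irr_dvd_linear Pd) Pb.
rewrite /val prodf_seq_eq0; apply/hasP; exists b => //=.
by rewrite Pb expr0n; case: (E b) Eb.
Qed.

(** The exponent splits into e blocks of length d; modulo [P] Frobenius identifies each with the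
    first, whose value is given by [residue_norm]. *)
Lemma linear_norm d P b e : P \in irr_monics F d ->
  P %| (b%:P - 'X) ^+ (\sum_(j < d * e) q ^ j) - (P.[b] ^+ e)%:P.
Proof.
move=> Pd; have /irr_monicsP[Pirr Pmon Psz] := Pd.
have mi : monic_irreducible_poly P by split.
elim: e => [|e IHe]; first by rewrite muln0 big_ord0 !expr0 subrr dvdp0.
set L := b%:P - 'X in IHe *.
have -> : (\sum_(j < d * e.+1) q ^ j = \sum_(j < d) q ^ j + q ^ d * \sum_(j < d * e) q ^ j)%N.
  rewrite mulnS big_split_ord /= big_distrr /=; congr (_ + _)%N.
  by apply: eq_bigr => j _; rewrite expnD.
rewrite exprD exprM exprS polyCM.
set A := L ^+ _; set B := L ^+ (q ^ d); set s := (\sum_(j < d * e) _)%N in IHe *.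
have -> : A * B ^+ s - P.[b]%:P * (P.[b] ^+ e)%:P =
  (A - P.[b]%:P) * B ^+ s + P.[b]%:P * ((B ^+ s - L ^+ s) + (L ^+ s - (P.[b] ^+ e)%:P)).
  by ring.
apply: dvdp_add; first by rewrite dvdp_mulr // (residue_norm mi).
rewrite dvdp_mull // dvdp_add // subrXX dvdp_mulr //.
by have := residue_frobenius mi Psz L 1; rewrite expn1.
Qed.

Lemma val_residue d P e m : P \in irr_monics F d ->
  P %| f ^+ (m * \sum_(j < d * e) q ^ j) - (val P ^+ (e * m))%:P.
Proof.
move=> Pd; have modX (a b : {poly F}) n : P %| a - b -> P %| a ^+ n - b ^+ n.
  by move=> ab; rewrite subrXX dvdp_mulr.
have modM (a b c e' : {poly F}) : P %| a - b -> P %| c - e' -> P %| a * c - b * e'.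
  move=> ab ce; have -> : a * c - b * e' = (a - b) * c + b * (c - e') by ring.
  by apply: dvdp_add; [exact: dvdp_mulr | exact: dvdp_mull].
rewrite mulnC exprM [in X in _ - X]exprM polyC_exp; apply: (modX).
rewrite /f /val -!prodrXl rmorph_prod /=.
apply: (big_ind2 (fun p r => P %| p - r)) => [|p p' r r'|b _]; first by rewrite subrr dvdp0.
  exact: modM.
by rewrite exprAC [(_ ^+ E b) ^+ e]exprAC polyC_exp; apply/modX/linear_norm.
Qed.

Variable nu : nat.
Hypothesis nu0 : (0 < nu)%N.
Let M := (q ^ nu)%N.
Let t := (M.-1 %/ k)%N.

Let q1 : (1 < q)%N. Proof. exact: finNzRing_gt1. Qed.

Let geom n : (q.-1 * \sum_(j < n) q ^ j = (q ^ n).-1)%N.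
Proof. by rewrite -predn_exp. Qed.

Let ktE : (k * t = M.-1)%N.
Proof. by rewrite mulnC divnK // -geom dvdn_mulr. Qed.

Let ME : M = (k * t).+1.
Proof. by rewrite ktE prednK // expn_gt0 ltnW. Qed.

Let t0 : (0 < t)%N.
Proof.
rewrite divn_gt0 ?(ltnW k2) //; apply: dvdn_leq; last by rewrite -ktE dvdn_mulr.
have : (q ^ 1 <= M)%N by rewrite leq_exp2l.
by rewrite expn1; move: q1; lia.
Qed.

(** Both sides times k are M^2 - 1. It identifies the exponent of the auxiliary construction with
    that of [val_residue]. *)
Let tM : (t * M.+1 = q.-1 %/ k * \sum_(j < nu.*2) q ^ j)%N.
Proof.
have k0 : (0 < k)%N by rewrite ltnW.
apply/eqP; rewrite -(eqn_pmul2l k0) !mulnA ktE [(k * _)%N]mulnC divnK // geom.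
by rewrite -addnn expnD -/M ME /=; apply/eqP; lia.
Qed.

Let fE : f = (b0%:P - 'X) * \prod_(b <- S') (b%:P - 'X) ^+ E b.
Proof. by rewrite /f big_cons Eb0 expr1. Qed.

Let fsz : (size f <= D.+1)%N.
Proof.
rewrite /f /D; elim: S => [|b s IHs]; first by rewrite !big_nil size_poly1.
rewrite !big_cons; apply: size_mul_le => //.
apply: leq_trans (size_exp_le (n := 1) _ _) _; last by rewrite mul1n.
by rewrite -opprB size_polyN size_XsubC.
Qed.

Let fb0 : (\prod_(b <- S') (b%:P - 'X) ^+ E b).[b0] != 0.
Proof.
rewrite horner_prod prodf_seq_neq0; apply/allP => b bS /=.
rewrite horner_exp expf_neq0 // !hornerE subr_eq0; apply: contraNneq b0S' => <-.
exact: bS.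
Qed.

Let deg (P : {poly F}) := (size P).-1.
Let chi_at P := X P ^+ (nu.*2 %/ deg P).
Let class (z : algC) := [seq P <- prime_list F nu.*2 | chi_at P == z].

(** All primes of the class divide one auxiliary polynomial of degree about M (t + D); as k t = M -
    1, multiplying by k gives the main term M^2. *)
Lemma class_bound z : z != 0 ->
  (k * \sum_(P <- class z) deg P <= M ^ 2 + (2 * k * D).+1 * M)%N.
Proof.
move=> z0; case E0 : (class z) => [|P0 cl]; first by rewrite big_nil muln0.
have nu2 : (0 < nu.*2)%N by rewrite double_gt0.
have inclass P : P \in class z -> exists d e, [/\ P \in irr_monics F d,
    (nu.*2 = d * e)%N, val P != 0 & chi (val P ^+ e) = z].
  rewrite mem_filter => /andP[/eqP Pz /(prime_listP _ nu2)[d dn Pd]].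
  have /irr_monicsP[_ _ Psz] := Pd.
  have d0 := dvdn_gt0 nu2 dn; exists d, (nu.*2 %/ d)%N.
  have zE : chi (val P ^+ (nu.*2 %/ d)) = z.
    by rewrite (chi_exp chiP) -Pz /chi_at /deg Psz.
  split => //; first by rewrite mulnC divnK.
  have : val P ^+ (nu.*2 %/ d) != 0 by rewrite -(chi_neq0 chiP) zE.
  by rewrite expf_eq0 divn_gt0 // dvdn_leq.
have P0cl : P0 \in class z by rewrite E0 mem_head.
have [d0 [e0 [P0d n0E v0 z0E]]] := inclass P0 P0cl.
(* By [chi_eq] this power depends only on z, so one member of the class determines [w] for all. *)
pose w := (val P0 ^+ e0) ^+ (q.-1 %/ k).
have [A A0 testA] := test_poly_kernel w k2 t0 ME fb0 fsz.
have aux0 := aux_poly_neq0 k2 t0 ME fE fb0 fsz A0.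
have auxsz := size_aux_poly k2 t0 ME fb0 fsz A.
set G := aux_poly _ _ _ _ in aux0 auxsz.
have dvdG P : P \in class z -> P %| G.
  move=> /inclass[d [e [Pd nE vP zE]]]; have /irr_monicsP[Pirr Pmon Psz] := Pd.
  have mi : monic_irreducible_poly P by split.
  apply: (aux_poly_dvd k2 t0 ME fb0 fsz Pirr (val_neq0 Pd vP) _ _ testA).
    rewrite -expnD addnn nE expnM; exact: (residue_frobenius mi Psz).
  rewrite tM nE; have := val_residue e (q.-1 %/ k) Pd; rewrite [val P ^+ (_ * _)]exprM.
  by rewrite (chi_eq chiP (y := val P0 ^+ e0)) ?expf_neq0 // zE z0E.
have degG : (\sum_(P <- class z) deg P <= (size G).-1)%N.
  apply: sum_degrees_le => // [|P Pcl]; first by rewrite filter_uniq ?prime_list_uniq.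
  by have [d [e [Pd _ _ _]]] := inclass P Pcl; exists d.
rewrite -E0; apply: leq_trans (leq_mul (leqnn k) degG) _.
have Gsz : ((size G).-1 <= t.-1 + (D * (t * k.-1) + M * (t + D).-1))%N.
  by rewrite -subn1 leq_subLR add1n.
apply: leq_trans (leq_mul (leqnn k) Gsz) _.
have ktM : (k * t <= M)%N by rewrite ME leqnSn.
rewrite !mulnDr.
have i1 : (k * t.-1 <= M)%N.
  by apply: leq_trans (leq_mul (leqnn k) (leq_pred t)) _.
have i2 : (k * (D * (t * k.-1)) <= k * D * M)%N.
  have -> : (k * (D * (t * k.-1)) = k.-1 * D * (k * t))%N by ring.
  by rewrite leq_mul // leq_mul // leq_pred.
have i3 : (k * (M * (t + D).-1) <= M ^ 2 + k * D * M)%N.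
  have -> : (k * (M * (t + D).-1) = M * (k * (t + D).-1))%N by ring.
  have : (k * (t + D).-1 <= M + k * D)%N.
    apply: leq_trans (leq_mul (leqnn k) (leq_pred _)) _.
    by rewrite mulnDr leq_add2r.
  move/(leq_mul (leqnn M)) => /leq_trans; apply.
  by rewrite mulnDr expnS expn1 [(M * (k * D))%N]mulnC.
apply: leq_trans (leq_add i1 (leq_add i2 i3)) _.
by apply: eq_leq; rewrite mulSn -mulnA mul2n -addnn mulnDl; ring.
Qed.

(** An irreducible [P] with a root b in [S] is X - b. *)
Lemma bad_bound : (\sum_(P <- prime_list F nu.*2 | X P == 0%R) deg P <= size S)%N.
Proof.
have nu2 : (0 < nu.*2)%N by rewrite double_gt0.
rewrite -big_filter; pose G : {poly F} := \prod_(b <- S) ('X - b%:P).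
have G0 : G != 0 by rewrite monic_neq0 ?monic_prod_XsubC.
have := @sum_degrees_le F [seq P <- prime_list F nu.*2 | X P == 0] G _ _ G0 _.
rewrite size_prod_XsubC; apply.
- by rewrite filter_uniq ?prime_list_uniq.
- by move=> P; rewrite mem_filter => /andP[_ /(prime_listP _ nu2)[d _ Pd]]; exists d.
move=> P; rewrite mem_filter => /andP[XP0 /(prime_listP _ nu2)[d _ Pd]].
have : ~~ (val P != 0) by rewrite -(chi_neq0 chiP) negbK.
rewrite negbK /val prodf_seq_eq0 => /hasP[b bS] /=.
rewrite expf_eq0 => /andP[_ Pb].
have Pb' : 'X - b%:P %| P by rewrite dvdp_XsubCl.
have /irr_monicsP[[_ Pmin] Pmon _] := Pd.
have /Pmin : size ('X - b%:P) != 1 by rewrite size_XsubC.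
move=> /(_ Pb') /eqp_dvdl <-.
by rewrite dvdp_XsubCl /root horner_prod prodf_seq_eq0; apply/hasP; exists b; rewrite //= hornerXsubC subrr.
Qed.

(** No class can fall far below M^2/k, since the k classes and the bad primes have total degree M^2.
    The common main term cancels because the k-th roots of unity sum to 0, and O(M) remains. *)
Lemma prime_sum_bound :
  `|prime_sum X nu.*2| <= (k * (2 * (2 * k * D).+1 + size S))%:R * M%:R.
Proof.
have nu2 : (0 < nu.*2)%N by rewrite double_gt0.
have k0 : (0 < k)%N by rewrite ltnW.
have [z zprim] := C_prim_root_exists k0.
pose N (j : 'I_k) := (\sum_(P <- class (z ^+ j)) deg P)%N.
have zn0 j : z ^+ j != 0 by rewrite expf_neq0 // (prim_root_eq0 zprim) -lt0n.
have splitP (P : {poly F}) : X P != 0 -> {j : 'I_k | chi_at P = z ^+ j}.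
  move=> XP; have : chi_at P ^+ k = 1.
    by rewrite /chi_at -exprM mulnC exprM (chi_unity kq chiP) ?expr1n // -(chi_neq0 chiP).
  by move/(prim_rootP zprim) => [j ->]; exists j.
have chi_at0 P : P \in prime_list F nu.*2 -> X P = 0 -> forall j, (chi_at P == z ^+ j) = false.
  move=> /(prime_listP _ nu2)[d dn /irr_monicsP[_ _ Psz]] XP j.
  rewrite /chi_at XP expr0n /deg Psz /= eqn0Ngt divn_gt0 ?(dvdn_gt0 nu2) // dvdn_leq //=.
  by rewrite eq_sym (negPf (zn0 j)).
have chi_atE P (j0 : 'I_k) : chi_at P = z ^+ j0 -> forall j : 'I_k, (chi_at P == z ^+ j) = (j == j0).
  move=> -> j; rewrite (eq_prim_root_expr zprim) !modn_small // eq_sym.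
  by [].
have sumE : prime_sum X nu.*2 = \sum_(j < k) z ^+ j *+ N j.
  rewrite prime_sumE //.
  rewrite (eq_bigr (fun j : 'I_k => \sum_(P <- prime_list F nu.*2)
    if chi_at P == z ^+ j then z ^+ j *+ deg P else 0)) => [|j _]; last first.
    by rewrite /N /class big_filter -sumrMnr big_mkcond.
  rewrite exchange_big; apply: eq_big_seq => P PL; rewrite -/(chi_at P).
  have [XP|/splitP[j0 Pj0]] := eqVneq (X P) 0.
    rewrite big1 => [|j _]; last by rewrite chi_at0.
    rewrite -[chi_at P]mulr1n.
    have := PL => /(prime_listP _ nu2)[d dn /irr_monicsP[_ _ Psz]].
    by rewrite /chi_at XP expr0n /deg Psz /= eqn0Ngt divn_gt0 ?(dvdn_gt0 nu2) // dvdn_leq // mulr1n mul0rn.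
  rewrite (bigD1 j0) //= big1 ?addr0 => [|j jj0]; first by rewrite Pj0 eqxx.
  by rewrite (chi_atE P j0) // (negPf jj0).
have totalE : (\sum_(j < k) N j + \sum_(P <- prime_list F nu.*2 | X P == 0%R) deg P = M ^ 2)%N.
  rewrite -expnM muln2 -sum_prime_list //.
  rewrite (eq_bigr (fun j : 'I_k => \sum_(P <- prime_list F nu.*2)
    if chi_at P == z ^+ j then deg P else 0%N)%N) => [|j _]; last first.
    by rewrite /N /class big_filter big_mkcond.
  rewrite exchange_big [X in (_ + X)%N]big_mkcond -big_split; apply: eq_big_seq => P PL /=.
  have [XP|XP] := eqVneq (X P) 0.
    by rewrite big1 => [|j _]; last by rewrite chi_at0.
  have [j0 Pj0] := splitP P XP; rewrite addn0.
  rewrite (bigD1 j0) //= big1 ?addn0 => [|j jj0]; first by rewrite Pj0 eqxx.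
  by rewrite (chi_atE P j0) // (negPf jj0).
pose C := (2 * k * D).+1.
pose v (j : 'I_k) : algC := (k * N j)%:R - (M ^ 2)%:R.
have vC j : v j <= (C * M)%:R.
  by rewrite lerBlDr -natrD ler_nat addnC class_bound.
have sumz : \sum_(j < k) z ^+ j = 0.
  have z1 : z - 1 != 0.
    rewrite subr_eq0; apply/eqP => z1; have := prim_order_dvd zprim 1.
    by rewrite dvdn1 expr1 z1 eqxx => /eqP kE; move: k2; rewrite kE.
  apply: (mulfI z1); rewrite mulr0 -subrX1 (prim_expr_order zprim) subrr //.
have kaE : k%:R * prime_sum X nu.*2 = \sum_(j < k) z ^+ j * v j.
  rewrite (eq_bigr _ (fun (j : 'I_k) _ => mulrBr (z ^+ j) _ _)).
  rewrite sumrB -mulr_suml sumz mul0r subr0 sumE mulr_sumr; apply: eq_bigr => j _.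
  by rewrite -mulr_natr natrM; ring.
have vsum : - (k * size S * M)%:R <= \sum_(j < k) v j.
  rewrite /v sumrB -natr_sum -big_distrr /= sumr_const card_ord -[_ *+ k]mulr_natl -natrM.
  rewrite -totalE lerNl opprB -natrB ?leq_mul2l ?leq_addr ?orbT //.
  rewrite ler_nat -mulnBr addKn -mulnA leq_mul2l; apply/orP; right.
  by apply: leq_trans bad_bound _; rewrite leq_pmulr // expn_gt0 ltnW.
(* This is |v| = 2 max(v, 0) - v; after summation only a lower bound for the sum of the [v j] is
   needed. *)
have vnorm j : `|v j| <= (2 * C * M)%:R - v j.
  have vr : v j \is Num.real by rewrite /v rpredB ?realn.
  have CM0 : 0 <= (C * M)%:R :> algC by rewrite ler0n.
  have -> : (2 * C * M)%:R = (C * M)%:R + (C * M)%:R :> algC by rewrite -natrD -mulnA mul2n addnn.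
  rewrite lerBrDr; have [v0|v0] := real_ge0P vr; first by rewrite lerD.
  by rewrite addNr addr_ge0.
apply: (@le_trans _ _ (k%:R * `|prime_sum X nu.*2|)).
  by rewrite ler_peMl // ler1n.
rewrite -[k%:R in leLHS]normr_nat -normrM kaE.
apply: le_trans (ler_norm_sum _ _ _) _.
apply: (@le_trans _ _ (\sum_(j < k) ((2 * C * M)%:R - v j))).
  apply: ler_sum => j _; rewrite normrM normrX.
  have -> : `|z| = 1 by apply/eqP; rewrite -(pexpr_eq1 k0) // -normrX (prim_expr_order zprim) normr1.
  by rewrite expr1n mul1r.
rewrite sumrB sumr_const card_ord lerBlDr; apply: le_trans (lerD (lexx _) vsum).
rewrite lerBrDr -[_ *+ k]mulr_natr -!natrM -natrD ler_nat.
by rewrite -/C; apply: eq_leq; ring.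
Qed.

End Weil.

(** [S] omits [b0], so [size S] is the number of points minus one, the bound for the degree of the
    L-polynomial. *)
Theorem weil_bound (F : finFieldType) (k : nat) (chi : F -> algC) :
  (2 <= k)%N -> (k %| #|F|.-1)%N -> power_char k chi ->
  forall (b0 : F) (S : seq F) (E : F -> nat), uniq (b0 :: S) -> E b0 = 1%N ->
  `|\sum_a \prod_(b <- b0 :: S) chi (b - a) ^+ E b| <= sqrtC #|F|%:R *+ size S.
Proof.
move=> k2 kq chiP b0 S E Suniq Eb0.
rewrite -(monic_sum1 chiP).
set X := fun g : {poly F} => _.
pose D := (\sum_(b <- b0 :: S) E b)%N.
pose K := (k * (2 * (2 * k * D).+1 + size (b0 :: S)))%N.
apply: (@first_coef_bound (monic_sum X) (prime_sum X) (size S).+1 K%:R #|F|%:R) => //.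
- by rewrite ltr0n (ltn_trans _ (finNzRing_gt1 F)).
- apply: monic_sum0; rewrite /X big1 ?(pchi1 chiP) // => b _.
  by rewrite hornerC expr1n.
- by move=> n; apply: (monic_sum_eq0 k2 kq chiP Suniq Eb0).
- apply: log_derivative => [|g h]; rewrite /X.
    by rewrite big1 ?(pchi1 chiP) // => b _; rewrite hornerC expr1n.
  rewrite -(pchiM chiP) -big_split; congr chi; apply: eq_bigr => b _.
  by rewrite hornerM exprMn.
- move=> n; rewrite -natrX.
  exact: (prime_sum_bound k2 kq chiP Suniq Eb0 (nu := n.+1)).
Qed.

(** * Correlations of shifted characters *)

Section CharacterSums.
Variables (F : finFieldType) (k : nat) (chi : F -> algC).
Local Notation q := #|F|.
Local Notation sq := (sqrtC q%:R).
Hypotheses (k2 : (2 <= k)%N) (kq : (k %| q.-1)%N) (chiP : power_char k chi).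

Let k0 : (0 < k)%N. Proof. exact: ltnW. Qed.
Let k10 : (0 < k.-1)%N. Proof. by rewrite -ltnS prednK. Qed.

Lemma chi_conj y : (chi y)^* = chi y ^+ k.-1.
Proof.
have [->|y0] := eqVneq y 0; first by rewrite (pchi0 chiP) rmorph0 expr0n eqn0Ngt k10.
have c0 : chi y != 0 by rewrite (chi_neq0 chiP).
apply: (mulfI c0); rewrite -exprS prednK // (chi_unity kq chiP) // -normCK.
by rewrite (chi_norm k2 kq chiP) // expr1n.
Qed.

(** Repeated shifts in [l] are merged by adding exponents, so only the isolation of [b0] has to be
    checked in applications. *)
Lemma weil_shift (b0 : F) (l : seq (F * nat)) : b0 \notin map fst l ->
  `|\sum_x chi (x + b0) * \prod_(p <- l) chi (x + p.1) ^+ p.2| <= sq *+ size l.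
Proof.
move=> b0l; set S := undup (map fst l).
pose E b := if b == b0 then 1%N else (\sum_(p <- l | p.1 == b) p.2)%N.
have Su : uniq (b0 :: S) by rewrite /= undup_uniq mem_undup b0l.
have Eb0 : E b0 = 1%N by rewrite /E eqxx.
have := weil_bound k2 kq chiP Su Eb0.
rewrite (reindex_inj oppr_inj) /=.
rewrite (eq_bigr (fun x => chi (x + b0) * \prod_(p <- l) chi (x + p.1) ^+ p.2)) => [|x _].
  move=> /le_trans; apply; rewrite ler_wpMn2l ?sqrtC_ge0 ?ler0n //.
  by rewrite (leq_trans (size_undup _)) // size_map.
rewrite big_cons Eb0 expr1 opprK addrC; congr (_ * _).
transitivity (\prod_(b <- S) \prod_(p <- l | p.1 == b) chi (x + p.1) ^+ p.2).
  apply: eq_big_seq => b; rewrite mem_undup => bl; rewrite /E ifN; last first.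
    by apply: contraNneq b0l => <-.
  by rewrite expr_sum addrC; apply: eq_bigr => p /eqP ->.
rewrite (exchange_big_dep xpredT) //=; apply: eq_big_seq => p pl.
rewrite big_mkcond (bigD1_seq p.1) ?mem_undup ?map_f ?undup_uniq //= eqxx.
by rewrite big1 ?mulr1 // => b bp; rewrite eq_sym (negPf bp).
Qed.

(** Conjugation turns the exponent k - 1 at [b0] into 1 and multiplies the others by k - 1. *)
Lemma weil_shift_conj (b0 : F) (l : seq (F * nat)) : b0 \notin map fst l ->
  `|\sum_x chi (x + b0) ^+ k.-1 * \prod_(p <- l) chi (x + p.1) ^+ p.2| <= sq *+ size l.
Proof.
move=> b0l; rewrite -norm_conjC rmorph_sum.
have := @weil_shift b0 [seq (p.1, k.-1 * p.2)%N | p <- l].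
rewrite -map_comp size_map (eq_map (g := fst)) // => /(_ b0l).
rewrite (eq_bigr (fun x => (chi (x + b0) ^+ k.-1 * \prod_(p <- l) chi (x + p.1) ^+ p.2)^*)) // => x _.
rewrite rmorphM /= -chi_conj conjCK big_map rmorph_prod; congr (_ * _).
by apply: eq_bigr => p _; rewrite rmorphXn /= chi_conj exprM.
Qed.

Lemma sum_chi_exp e : (0 < e < k)%N -> \sum_x chi x ^+ e = 0.
Proof.
move=> ek; have [c c0 ce] := chi_nontrivial k2 kq chiP ek.
have : \sum_x chi x ^+ e = chi c ^+ e * \sum_x chi x ^+ e.
  rewrite [LHS](reindex_inj (mulfI c0)) mulr_sumr; apply: eq_bigr => x _.
  by rewrite /= (pchiM chiP) exprMn.
move/eqP; rewrite -{1}[\sum_x _]mul1r -subr_eq0 -mulrBl mulf_eq0 subr_eq0 eq_sym.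
by rewrite (negPf ce) => /eqP.
Qed.

Lemma sum_norm_chi e : (0 < e)%N -> \sum_x `|chi x ^+ e| ^+ 2 = q.-1%:R.
Proof.
move=> e0; rewrite (bigD1 0) //= (pchi0 chiP) expr0n eqn0Ngt e0 normr0 expr0n add0r.
rewrite (eq_bigr (fun=> 1)) => [|x x0]; last by rewrite normrX (chi_norm k2 kq chiP) // !expr1n.
by rewrite sumr_const cardC1.
Qed.

(** Neither exponent has to be 1, so [weil_bound] does not apply directly. By homogeneity |T b| is
    the same for all q - 1 nonzero shifts, while the sum of |T b|^2 over all shifts is at most (q -
    1) q by orthogonality. *)
Lemma jacobi_bound e1 e2 (b1 b2 : F) : (0 < e1)%N -> (0 < e2 < k)%N -> b1 != b2 ->
  `|\sum_x chi (x + b1) ^+ e1 * chi (x + b2) ^+ e2| <= sq.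
Proof.
move=> e10 ek b12; have /andP[e20 _] := ek.
pose T b := \sum_x chi x ^+ e1 * chi (x + b) ^+ e2.
have -> : \sum_x chi (x + b1) ^+ e1 * chi (x + b2) ^+ e2 = T (b2 - b1).
  rewrite /T (reindex_inj (addIr (- b1))); apply: eq_bigr => x _.
  by rewrite subrK; congr (_ * chi _ ^+ _); rewrite /=; ring.
have T1 b : b != 0 -> `|T b| = `|T 1|.
  move=> bn0; have -> : T b = chi b ^+ e1 * chi b ^+ e2 * T 1.
    rewrite /T [LHS](reindex_inj (mulfI bn0)) mulr_sumr; apply: eq_bigr => x _.
    have -> : b * x + b = b * (x + 1) by ring.
    by rewrite /= !(pchiM chiP) !exprMn mulrACA.
  by rewrite !normrM !normrX (chi_norm k2 kq chiP) // !expr1n !mul1r.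
rewrite T1 ?subr_eq0 1?eq_sym //.
pose K x y := \sum_b chi (x + b) ^+ e2 * (chi (y + b) ^+ e2)^*.
have Kxx x : K x x = q.-1%:R.
  rewrite -(sum_norm_chi e20) [RHS](reindex_inj (addrI x)); apply: eq_bigr => b _.
  by rewrite /= normCK.
have Kxy x y : x != y -> K x y = - 1.
  move=> xy; have c0 : x - y != 0 by rewrite subr_eq0.
  rewrite /K (reindex_inj (addIr (- y))) /=.
  rewrite (eq_bigr (fun u => chi (u + (x - y)) ^+ e2 * (chi u ^+ e2)^*)) => [|u _]; last first.
    by congr (chi _ ^+ _ * (chi _ ^+ _)^*); ring.
  rewrite (reindex_inj (mulfI c0)) /= (bigD1 0) //= mulr0 (pchi0 chiP) expr0n eqn0Ngt e20.
  rewrite rmorph0 mulr0 add0r.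
  (* Inversion turns the correlation into the sum of chi(v + 1)^e2 over v != 0, that is, the
     vanishing full sum minus its term 1 at v = 0. *)
  rewrite (reindex_inj invr_inj) /=.
  rewrite (eq_bigr (fun v => chi (v + 1) ^+ e2)) => [|v v0]; last first.
    have {}v0 : v != 0 by rewrite -invr_eq0.
    have -> : (x - y) * v^-1 + (x - y) = (x - y) * v^-1 * (v + 1).
      by rewrite mulrDr mulr1 mulfVK // addrC.
    have nz : (x - y) * v^-1 != 0 by rewrite mulf_neq0 // invr_eq0.
    by rewrite (pchiM chiP) exprMn mulrAC -normCK normrX (chi_norm k2 kq chiP) // !expr1n mul1r.
  have := sum_chi_exp ek; rewrite (reindex_inj (addIr 1)) (bigD1 0) //= add0r (pchi1 chiP) expr1n.
  move/eqP; rewrite addrC addr_eq0 => /eqP <-.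
  by apply: eq_bigl => v; rewrite invr_eq0.
have sumT : \sum_b `|T b| ^+ 2 <= (q.-1 * q)%:R.
  have -> : \sum_b `|T b| ^+ 2 = \sum_x \sum_y chi x ^+ e1 * (chi y ^+ e1)^* * K x y.
    transitivity (\sum_b \sum_x \sum_y (chi x ^+ e1 * chi (x + b) ^+ e2) * (chi y ^+ e1 * chi (y + b) ^+ e2)^*).
      apply: eq_bigr => b _; rewrite normCK rmorph_sum mulr_suml; apply: eq_bigr => x _.
      by rewrite mulr_sumr.
    rewrite exchange_big; apply: eq_bigr => x _; rewrite exchange_big; apply: eq_bigr => y _.
    rewrite mulr_sumr; apply: eq_bigr => b _; rewrite rmorphM /=; ring.
  have -> : \sum_x \sum_y chi x ^+ e1 * (chi y ^+ e1)^* * K x y =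
     \sum_x `|chi x ^+ e1| ^+ 2 * q%:R - `|\sum_x chi x ^+ e1| ^+ 2.
    rewrite normCK rmorph_sum mulr_suml -sumrB; apply: eq_bigr => x _.
    rewrite mulr_sumr (bigD1 x) //= Kxx [in RHS](bigD1 x) //= opprD addrA.
    congr (_ + _); last first.
      by rewrite -sumrN; apply: eq_bigr => y yx; rewrite Kxy 1?eq_sym // mulrN1.
    have qE : q%:R = q.-1%:R + 1 :> algC by rewrite -mulrSr prednK // ltnW // finNzRing_gt1.
    by rewrite -normCK qE; ring.
  rewrite -mulr_suml sum_norm_chi // -natrM lerBlDr lerDl exprn_ge0 //.
have : \sum_(b : F | b != 0) `|T 1| ^+ 2 <= (q.-1 * q)%:R.
  apply: le_trans sumT; rewrite [leRHS](bigD1 0) //=.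
  rewrite (eq_bigr (fun b => `|T b| ^+ 2)) => [|b b0]; last by rewrite T1.
  by rewrite lerDr exprn_ge0.
rewrite sumr_const cardC1 -[leLHS]mulr_natl natrM ler_pM2l ?ltr0n; last first.
  by rewrite -subn1 subn_gt0 finNzRing_gt1.
by move=> TT; rewrite -(@ler_pXn2r _ 2) ?nnegrE ?sqrtC_ge0 ?ler0n // sqrtCK.
Qed.
End CharacterSums.

(** * Moments of character sums over a set *)

Section Moments.
Variables (F : finFieldType) (k : nat) (chi : F -> algC).
Local Notation q := #|F|.
Local Notation sq := (sqrtC (q%:R : algC)).
Hypotheses (k2 : (2 <= k)%N) (kq : (k %| q.-1)%N) (chiP : power_char k chi).

Let k0 : (0 < k)%N. Proof. exact: ltnW. Qed.
Let kn0 : (k%:R : algC) != 0. Proof. by rewrite pnatr_eq0 -lt0n. Qed.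
Let sq0 : 0 <= sq. Proof. by rewrite sqrtC_ge0 ler0n. Qed.

Definition ind (y : F) : algC := (chi y == 1)%:R.

(* The exponents run over 1..k instead of 0..k-1: [chi y ^+ k] is the trivial
   character vanishing at 0, whereas [chi 0 ^+ 0 = 1]. *)
Lemma indE y : k%:R * ind y = \sum_(e < k) chi y ^+ e.+1.
Proof.
rewrite /ind; have [y1|y1] := eqVneq (chi y) 1.
  rewrite mulr1 (eq_bigr (fun=> 1)) => [|e _]; last by rewrite y1 expr1n.
  by rewrite sumr_const card_ord.
rewrite mulr0; apply/esym.
have [->|y0] := eqVneq y 0.
  by rewrite big1 // => e _; rewrite (pchi0 chiP) expr0n.
have c1 : chi y - 1 != 0 by rewrite subr_eq0.
apply: (mulfI c1); rewrite mulr0.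
rewrite (eq_bigr (fun e : 'I_k => chi y * chi y ^+ e)) => [|e _]; last by rewrite exprS.
by rewrite -mulr_sumr mulrCA -subrX1 (chi_unity kq chiP) // subrr mulr0.
Qed.

Lemma ind_ge0 y : 0 <= ind y. Proof. exact: ler0n. Qed.
Lemma ind_le1 y : ind y <= 1. Proof. by rewrite /ind lern1 leq_b1. Qed.

Lemma chi_le1 y e : `|chi y ^+ e| <= 1.
Proof.
rewrite normrX exprn_ile1 //; have [->|y0] := eqVneq y 0.
  by rewrite (pchi0 chiP) normr0 ler01.
by rewrite (chi_norm k2 kq chiP).
Qed.

Lemma norm_sum_le_card (f : F -> algC) : (forall x, `|f x| <= 1) -> `|\sum_x f x| <= q%:R.
Proof.
move=> f1; apply: le_trans (ler_norm_sum _ _ _) _.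
by apply: le_trans (ler_sum _ (fun x _ => f1 x)) _; rewrite sumr_const.
Qed.

Lemma sum_last_ord : \sum_(e < k) (e.+1 == k)%:R = 1 :> algC.
Proof.
have kP : (k.-1 < k)%N by rewrite prednK.
rewrite (bigD1 (Ordinal kP)) //= prednK // eqxx big1 ?addr0 // => e ek.
case: eqP => // eE; case/negP: ek; apply/eqP/val_inj => /=.
by apply: succn_inj; rewrite prednK.
Qed.

(** Of the k^2 pairs of exponents only the one where both equal k has a main term; the others are
    Jacobi sums. *)
Lemma pair_count (b1 b2 : F) : b1 != b2 ->
  (k ^ 2)%:R * \sum_x ind (x + b1) * ind (x + b2) <= q%:R + (k ^ 2)%:R * sq.
Proof.
move=> b12.
pose W (e1 e2 : 'I_k) := \sum_x chi (x + b1) ^+ e1.+1 * chi (x + b2) ^+ e2.+1.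
have WE : (k ^ 2)%:R * \sum_x ind (x + b1) * ind (x + b2) = \sum_(e1 < k) \sum_(e2 < k) W e1 e2.
  transitivity (\sum_x (k%:R * ind (x + b1)) * (k%:R * ind (x + b2))).
    by rewrite mulr_sumr; apply: eq_bigr => x _; rewrite natrX expr2 mulrACA.
  rewrite (eq_bigr (fun x => \sum_(e1 < k) \sum_(e2 < k) chi (x + b1) ^+ e1.+1 * chi (x + b2) ^+ e2.+1)).
    by rewrite exchange_big; apply: eq_bigr => e1 _; rewrite exchange_big.
  by move=> x _; rewrite !indE mulr_suml; apply: eq_bigr => e1 _; rewrite mulr_sumr.
have Wle (e1 e2 : 'I_k) : `|W e1 e2| <= ((e1.+1 == k) && (e2.+1 == k))%:R * q%:R + sq.
  have [e1k|e1k] := eqVneq e1.+1 k; last first.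
    rewrite mul0r add0r /W; under eq_bigr do rewrite mulrC.
    apply: (jacobi_bound k2 kq chiP) => //; last by rewrite eq_sym.
    by rewrite /= ltn_neqAle e1k ltn_ord.
  have [e2k|e2k] := eqVneq e2.+1 k; last first.
    rewrite mul0r add0r; apply: (jacobi_bound k2 kq chiP) => //.
    by rewrite /= ltn_neqAle e2k ltn_ord.
  rewrite mul1r; apply: le_trans (_ : q%:R <= _); last by rewrite lerDl.
  apply: norm_sum_le_card => x; rewrite normrM.
  by rewrite mulr_ile1 // chi_le1.
rewrite WE; apply: (@le_trans _ _ (\sum_(e1 < k) \sum_(e2 < k) `|W e1 e2|)).
  rewrite -[leLHS]ger0_norm.
    by apply: le_trans (ler_norm_sum _ _ _) (ler_sum _ _) => e1 _; apply: ler_norm_sum.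
  rewrite -WE mulr_ge0 ?ler0n ?sumr_ge0 // => x _.
  by rewrite mulr_ge0 ?ind_ge0.
apply: le_trans (ler_sum _ (fun e1 _ => ler_sum _ (fun e2 _ => Wle e1 e2))) _.
rewrite (eq_bigr (fun e1 : 'I_k => (e1.+1 == k)%:R * q%:R + k%:R * sq)) => [|e1 _].
  rewrite big_split /= -mulr_suml sum_last_ord mul1r sumr_const card_ord.
  by rewrite -[_ *+ k]mulr_natl mulrA -natrM.
rewrite big_split /= sumr_const card_ord -[sq *+ k]mulr_natl; congr (_ + _).
under eq_bigr do rewrite -mulnb natrM.
by rewrite -mulr_suml -mulr_sumr sum_last_ord mulr1.
Qed.
Lemma sum_ind : k%:R * \sum_x ind x = q.-1%:R.
Proof.
rewrite mulr_sumr (eq_bigr _ (fun x _ => indE x)) exchange_big /=.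
have kP : (k.-1 < k)%N by rewrite prednK.
rewrite (bigD1 (Ordinal kP)) //= [X in _ + X]big1 ?addr0 => [|e ek]; last first.
  rewrite (sum_chi_exp k2 kq chiP) //= ltn_neqAle ltn_ord andbT.
  apply: contra ek => /eqP eE; apply/eqP/val_inj/succn_inj => /=.
  by rewrite prednK.
rewrite prednK // (bigD1 0) //= (pchi0 chiP) expr0n eqn0Ngt k0 add0r.
rewrite (eq_bigr (fun=> 1)) => [|x x0]; last exact: chi_unity.
by rewrite sumr_const cardC1.
Qed.

Variable B : {set F}.
Local Notation m := #|B|.

Lemma sum_delta (b : F) (g : F -> algC) : b \in B ->
  \sum_(c in B) (b == c)%:R * g c = g b.
Proof.
move=> bB; rewrite (bigD1 b) //= eqxx mul1r big1 ?addr0 // => c /andP[_ cb].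
by rewrite eq_sym (negPf cb) mul0r.
Qed.

(** The exponent k - 1 stands for complex conjugation. The weights are [chi] and its conjugate in
    the fourth moment, and [ind] twice in the mixed one. *)
Definition quad_sum (w1 w2 : F -> algC) (b1 b2 b3 b4 : F) :=
  \sum_x chi (x + b1) * chi (x + b2) ^+ k.-1 * (w1 (x + b3) * w2 (x + b4)).

Lemma quad_sum_le_card w1 w2 b1 b2 b3 b4 :
  (forall y, `|w1 y| <= 1) -> (forall y, `|w2 y| <= 1) ->
  `|quad_sum w1 w2 b1 b2 b3 b4| <= q%:R.
Proof.
move=> w11 w21; apply: norm_sum_le_card => x.
rewrite !normrM !mulr_ile1 ?mulr_ge0 ?normr_ge0 ?chi_le1 //.
by rewrite -[chi _]expr1 chi_le1.
Qed.

Lemma quad_sum_weil1 e3 e4 b1 b2 b3 b4 : b1 != b2 -> b1 != b3 -> b1 != b4 ->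
  `|quad_sum (fun y => chi y ^+ e3) (fun y => chi y ^+ e4) b1 b2 b3 b4| <= 3 * sq.
Proof.
move=> b12 b13 b14; rewrite mulr_natl.
have := @weil_shift F k chi k2 kq chiP b1 [:: (b2, k.-1); (b3, e3); (b4, e4)].
rewrite !inE !negb_or b12 b13 b14 => /(_ isT); congr (_ <= _); congr Num.norm.
by apply: eq_bigr => x _; rewrite !big_cons big_nil mulr1 mulrA.
Qed.

Lemma quad_sum_weil2 e3 e4 b1 b2 b3 b4 : b2 != b1 -> b2 != b3 -> b2 != b4 ->
  `|quad_sum (fun y => chi y ^+ e3) (fun y => chi y ^+ e4) b1 b2 b3 b4| <= 3 * sq.
Proof.
move=> b21 b23 b24; rewrite mulr_natl.
have := @weil_shift_conj F k chi k2 kq chiP b2 [:: (b1, 1%N); (b3, e3); (b4, e4)].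
rewrite !inE !negb_or b21 b23 b24 => /(_ isT); congr (_ <= _); congr Num.norm.
by apply: eq_bigr => x _; rewrite !big_cons big_nil mulr1 mulrCA mulrA expr1.
Qed.

Lemma quad_sumC b1 b2 b3 b4 :
  quad_sum (fun y => chi y ^+ 1) (fun y => chi y ^+ k.-1) b1 b2 b3 b4 =
  quad_sum (fun y => chi y ^+ 1) (fun y => chi y ^+ k.-1) b3 b4 b1 b2.
Proof. by apply: eq_bigr => x _; rewrite !expr1 mulrC. Qed.

(** If some shift differs from the three others, Weil's bound applies there, the exponent being 1 or
    k - 1; [quad_sumC] moves it to the first two places. Otherwise the shifts coincide in pairs, in
    one of three ways, and the trivial bound q is used. *)
Lemma quad_sum_bound b1 b2 b3 b4 :
  `|quad_sum (fun y => chi y ^+ 1) (fun y => chi y ^+ k.-1) b1 b2 b3 b4| <=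
  ((b1 == b2)%:R * (b3 == b4)%:R + (b1 == b3)%:R * (b2 == b4)%:R +
   (b1 == b4)%:R * (b3 == b2)%:R) * q%:R + 3 * sq.
Proof.
set W := quad_sum _ _ _ _ _ _.
have W1 : `|W| <= q%:R by apply: quad_sum_le_card => y; apply: chi_le1.
have q0 : 0 <= q%:R :> algC by rewrite ler0n.
have sq3 : 0 <= 3 * sq by rewrite mulr_ge0 ?ler0n.
have triv (d : algC) : 1 <= d -> `|W| <= d * q%:R + 3 * sq.
  by move=> d1; apply: le_trans W1 _; rewrite ler_wpDr // ler_peMl.
have main (d : algC) : 0 <= d -> `|W| <= 3 * sq -> `|W| <= d * q%:R + 3 * sq.
  by move=> d0 WW; rewrite ler_wpDl // mulr_ge0.
have nn (x y : bool) : 0 <= x%:R * y%:R :> algC by rewrite mulr_ge0 ?ler0n.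
have [d12|d12] := boolP ((b1 == b2) && (b3 == b4)).
  by case/andP: d12 => -> ->; apply: triv; rewrite mulr1 -addrA lerDl addr_ge0.
have [d13|d13] := boolP ((b1 == b3) && (b2 == b4)).
  by case/andP: d13 => -> ->; apply: triv; rewrite mulr1 addrAC lerDr addr_ge0.
have [d14|d14] := boolP ((b1 == b4) && (b3 == b2)).
  by case/andP: d14 => -> ->; apply: triv; rewrite mulr1 lerDr addr_ge0.
apply: main; first by rewrite !addr_ge0.
have [b12|b12] := eqVneq b1 b2.
  have b34 : b3 != b4 by move: d12; rewrite b12 eqxx.
  have [b32|b32] := eqVneq b3 b2; last first.
    by rewrite /W quad_sumC; apply: quad_sum_weil1; rewrite ?b12.
  rewrite /W quad_sumC; apply: quad_sum_weil2; rewrite 1?eq_sym ?b12 -?b32 //.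
have [b14|b14] := eqVneq b1 b4.
  have b32 : b3 != b2 by move: d14; rewrite b14 eqxx.
  have [b34|b34] := eqVneq b3 b4; last first.
    by rewrite /W quad_sumC; apply: quad_sum_weil1; rewrite ?b14.
  by apply: quad_sum_weil2; rewrite 1?eq_sym ?b14 -?b34 // -b34.
have [b13|b13] := eqVneq b1 b3; last by apply: quad_sum_weil1.
have b24 : b2 != b4 by move: d13; rewrite b13 eqxx.
by apply: quad_sum_weil2; rewrite // 1?eq_sym // -b13.
Qed.

(** * Summation over quadruples and their coincidences *)

Definition sum4 (g : F -> F -> F -> F -> algC) :=
  \sum_(b1 in B) \sum_(b2 in B) \sum_(b3 in B) \sum_(b4 in B) g b1 b2 b3 b4.

Lemma le_sum4 g h : (forall b1 b2 b3 b4, g b1 b2 b3 b4 <= h b1 b2 b3 b4) ->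
  sum4 g <= sum4 h.
Proof.
by move=> gh; do 4![apply: ler_sum => ? _]; apply: gh.
Qed.

Lemma norm_sum4 g : `|sum4 g| <= sum4 (fun b1 b2 b3 b4 => `|g b1 b2 b3 b4|).
Proof.
do 3![apply: le_trans (ler_norm_sum _ _ _) (ler_sum _ _) => ? _].
exact: ler_norm_sum.
Qed.

Lemma sum4D g h : sum4 (fun b1 b2 b3 b4 => g b1 b2 b3 b4 + h b1 b2 b3 b4) = sum4 g + sum4 h.
Proof.
rewrite /sum4 -big_split; apply: eq_bigr => b1 _; rewrite -big_split; apply: eq_bigr => b2 _.
by rewrite -big_split; apply: eq_bigr => b3 _; rewrite -big_split.
Qed.

Lemma sum4Z g c : sum4 (fun b1 b2 b3 b4 => g b1 b2 b3 b4 * c) = sum4 g * c.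
Proof.
rewrite /sum4 mulr_suml; apply: eq_bigr => b1 _; rewrite mulr_suml; apply: eq_bigr => b2 _.
by rewrite mulr_suml; apply: eq_bigr => b3 _; rewrite mulr_suml.
Qed.

Lemma sum4_const c : sum4 (fun _ _ _ _ => c) = (m ^ 4)%:R * c.
Proof.
by rewrite /sum4 !sumr_const -!mulrnA mulr_natl; congr (_ *+ _); rewrite !expnS expn1 !mulnA.
Qed.

Let delta (a b : F) : algC := (a == b)%:R.

Let sumd (b : F) c : b \in B -> \sum_(b' in B) c * delta b b' = c.
Proof.
move=> bB; rewrite -mulr_sumr; have := sum_delta (fun=> 1) bB.
by under eq_bigr do rewrite mulr1; rewrite /delta => ->; rewrite mulr1.
Qed.

Let deltaC a b : delta a b = delta b a.
Proof. by rewrite /delta eq_sym. Qed.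

Let sumB (c : algC) : \sum_(b in B) c = m%:R * c.
Proof. by rewrite sumr_const mulr_natl. Qed.

Lemma sum4_12 : sum4 (fun b1 b2 _ _ => delta b1 b2) = (m ^ 3)%:R.
Proof.
rewrite /sum4 (eq_bigr (fun=> (m ^ 2)%:R)) => [|b1 b1B].
  by rewrite sumB -natrM -expnS.
rewrite (eq_bigr (fun b2 => (m ^ 2)%:R * delta b1 b2)) => [|b2 _]; first by rewrite sumd.
by rewrite !sumB mulrA -natrM mulnn.
Qed.

Lemma sum4_12_34 : sum4 (fun b1 b2 b3 b4 => delta b1 b2 * delta b3 b4) = (m ^ 2)%:R.
Proof.
rewrite /sum4 (eq_bigr (fun=> m%:R)) => [|b1 b1B]; first by rewrite sumB -natrM.
rewrite (eq_bigr (fun b2 => m%:R * delta b1 b2)) => [|b2 _]; first by rewrite sumd.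
rewrite -(sumB (delta b1 b2)); apply: eq_bigr => b3 b3B; exact: sumd.
Qed.

Lemma sum4_13_24 : sum4 (fun b1 b2 b3 b4 => delta b1 b3 * delta b2 b4) = (m ^ 2)%:R.
Proof.
rewrite /sum4 (eq_bigr (fun=> m%:R * 1)) => [|b1 b1B]; first by rewrite mulr1 sumB -natrM.
rewrite -sumB; apply: eq_bigr => b2 b2B.
rewrite (eq_bigr (fun b3 => 1 * delta b1 b3)) => [|b3 _]; first by rewrite sumd.
by rewrite mul1r sumd.
Qed.

Lemma sum4_14_32 : sum4 (fun b1 b2 b3 b4 => delta b1 b4 * delta b3 b2) = (m ^ 2)%:R.
Proof.
rewrite /sum4 (eq_bigr (fun=> m%:R * 1)) => [|b1 b1B]; first by rewrite mulr1 sumB -natrM.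
rewrite -sumB; apply: eq_bigr => b2 b2B.
rewrite (eq_bigr (fun b3 => 1 * delta b2 b3)) => [|b3 _]; first by rewrite sumd.
rewrite (eq_bigr (fun b4 => delta b3 b2 * delta b1 b4)) => [|b4 _]; last by rewrite mulrC.
by rewrite sumd // mul1r deltaC.
Qed.

Lemma sum4_12_13_24 : sum4 (fun b1 b2 b3 b4 => delta b1 b2 * delta b1 b3 * delta b2 b4) = m%:R.
Proof.
rewrite /sum4 (eq_bigr (fun=> 1)) => [|b1 b1B]; first by rewrite sumB mulr1.
rewrite (eq_bigr (fun b2 => 1 * delta b1 b2)) => [|b2 b2B]; first by rewrite sumd.
rewrite (eq_bigr (fun b3 => delta b1 b2 * delta b1 b3)) => [|b3 _]; first by rewrite sumd // mul1r.
by rewrite sumd.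
Qed.

Lemma sum4_12_14_32 : sum4 (fun b1 b2 b3 b4 => delta b1 b2 * delta b1 b4 * delta b3 b2) = m%:R.
Proof.
rewrite /sum4 (eq_bigr (fun=> 1)) => [|b1 b1B]; first by rewrite sumB mulr1.
rewrite (eq_bigr (fun b2 => 1 * delta b1 b2)) => [|b2 b2B]; first by rewrite sumd.
rewrite (eq_bigr (fun b3 => delta b1 b2 * delta b2 b3)) => [|b3 _]; first by rewrite sumd // mul1r.
rewrite (eq_bigr (fun b4 => delta b1 b2 * delta b3 b2 * delta b1 b4)) => [|b4 _]; last by rewrite mulrAC.
by rewrite sumd // [delta b3 b2]deltaC.
Qed.

Lemma sum4_quad w1 w2 : sum4 (quad_sum w1 w2) =
  \sum_x `|\sum_(b in B) chi (x + b)| ^+ 2 *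
     ((\sum_(b in B) w1 (x + b)) * \sum_(b in B) w2 (x + b)).
Proof.
transitivity (\sum_x sum4 (fun b1 b2 b3 b4 =>
    chi (x + b1) * chi (x + b2) ^+ k.-1 * (w1 (x + b3) * w2 (x + b4)))).
  rewrite /sum4 /quad_sum [RHS]exchange_big /=; apply: eq_bigr => b1 _.
  rewrite [RHS]exchange_big /=; apply: eq_bigr => b2 _.
  rewrite [RHS]exchange_big /=; apply: eq_bigr => b3 _.
  by rewrite [RHS]exchange_big.
apply: eq_bigr => x _; rewrite normCK rmorph_sum /sum4.
rewrite mulr_suml mulr_suml; apply: eq_bigr => b1 _.
rewrite mulr_sumr mulr_suml; apply: eq_bigr => b2 _.
rewrite mulr_suml mulr_sumr; apply: eq_bigr => b3 _.
by rewrite !mulr_sumr; apply: eq_bigr => b4 _; rewrite /= (chi_conj k2 kq chiP).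
Qed.

Variable A : {set F}.
Hypothesis AB : forall a b, a \in A -> b \in B -> chi (a + b) = 1.

Lemma sum_over_A (g : F -> algC) c : (forall x, 0 <= g x) -> (forall a, a \in A -> g a = c) ->
  #|A|%:R * c <= \sum_x g x.
Proof.
move=> g0 gA; rewrite (bigID (mem A)) /= (eq_bigr (fun=> c)) //.
by rewrite sumr_const mulr_natl lerDl sumr_ge0.
Qed.

Let fA a : a \in A -> \sum_(b in B) chi (a + b) = m%:R.
Proof. by move=> aA; rewrite (eq_bigr (fun=> 1)) ?sumr_const // => b; apply: AB. Qed.

Lemma fourth_moment :
  (#|A| * m ^ 4)%:R <= (3 * m ^ 2 * q)%:R + (3 * m ^ 4)%:R * sq.
Proof.
set Q := sum4 (quad_sum (fun y => chi y ^+ 1) (fun y => chi y ^+ k.-1)).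
have lo : (#|A| * m ^ 4)%:R <= Q.
  rewrite /Q sum4_quad natrM; apply: sum_over_A => [x|a aA].
    have -> : \sum_(b in B) chi (x + b) ^+ k.-1 = (\sum_(b in B) chi (x + b) ^+ 1)^*.
      by rewrite rmorph_sum; apply: eq_bigr => b _; rewrite expr1 -(chi_conj k2 kq chiP).
    by rewrite -normCK mulr_ge0 // exprn_ge0.
  have fAe e : \sum_(b in B) chi (a + b) ^+ e = m%:R.
    by rewrite (eq_bigr (fun=> 1)) ?sumr_const // => b bB; rewrite AB // expr1n.
  by rewrite fA // !fAe normr_nat -!natrX -!natrM; congr _%:R; ring.
apply: (le_trans lo); rewrite -[Q]ger0_norm; last by apply: (le_trans _ lo); rewrite ler0n.
apply: le_trans (norm_sum4 _) _.
apply: le_trans (le_sum4 quad_sum_bound) _.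
rewrite sum4D sum4Z !sum4D sum4_const sum4_12_34 sum4_13_24 sum4_14_32.
rewrite mulrA -!natrD -!natrM lerD //; last by rewrite mulnC.
by rewrite ler_nat; apply: eq_leq; ring.
Qed.

Section Mixed.
Variable T : algC.
Hypothesis T0 : 0 <= T.
Hypothesis T_pair : forall b1 b2, b1 != b2 -> \sum_x ind (x + b1) * ind (x + b2) <= T.
Let n := \sum_x ind x.

Let n0 : 0 <= n. Proof. by apply: sumr_ge0 => x _; apply: ind_ge0. Qed.

Lemma quad_sum_ind_le b1 b2 b3 b4 :
  `|quad_sum ind ind b1 b2 b3 b4| <= \sum_x ind (x + b3) * ind (x + b4).
Proof.
apply: le_trans (ler_norm_sum _ _ _) (ler_sum _ _) => x _.
have i0 : 0 <= ind (x + b3) * ind (x + b4) by rewrite mulr_ge0 ?ind_ge0.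
rewrite normrM [X in _ * X]ger0_norm // ler_piMl // normrM mulr_ile1 ?chi_le1 //.
by rewrite -[chi _]expr1 chi_le1.
Qed.

(** Expanding both indicators gives k^2 sums, which the normalization k^-2 averages, so no power of
    k is lost. Only [b1] or [b2] may serve as the isolated point: the other exponents are
    arbitrary. *)
Lemma quad_sum_ind_weil b1 b2 b3 b4 : b1 != b2 ->
  ((b1 != b3) && (b1 != b4)) || ((b2 != b3) && (b2 != b4)) ->
  `|quad_sum ind ind b1 b2 b3 b4| <= 3 * sq.
Proof.
move=> b12 off; have kk0 : 0 < (k ^ 2)%:R :> algC by rewrite ltr0n expn_gt0 k0.
rewrite -(ler_pM2l kk0) -[(k ^ 2)%:R in leLHS]ger0_norm ?ler0n // -normrM.
have -> : (k ^ 2)%:R * quad_sum ind ind b1 b2 b3 b4 = \sum_(e3 < k) \sum_(e4 < k)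
    quad_sum (fun y => chi y ^+ e3.+1) (fun y => chi y ^+ e4.+1) b1 b2 b3 b4.
  rewrite /quad_sum; under [RHS]eq_bigr do rewrite exchange_big.
  rewrite [RHS]exchange_big mulr_sumr; apply: eq_bigr => x _.
  under eq_bigr do rewrite -mulr_sumr.
  rewrite -mulr_sumr; under eq_bigr do rewrite -mulr_sumr.
  by rewrite -mulr_suml -!indE natrX; ring.
apply: le_trans (_ : \sum_(e3 < k) \sum_(e4 < k) 3 * sq <= _); last first.
  by rewrite !sumr_const !card_ord -mulrnA mulnn [leRHS]mulr_natl.
apply: le_trans (ler_norm_sum _ _ _) (ler_sum _ _) => e3 _.
apply: le_trans (ler_norm_sum _ _ _) (ler_sum _ _) => e4 _.
by case/orP: off => /andP[? ?]; [apply: quad_sum_weil1 | apply: quad_sum_weil2; rewrite // eq_sym].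
Qed.

(** Main terms: n for b1 = b2 and b3 = b4, T for b1 = b2 and b3 != b4, T for b1 != b2 with {b3, b4}
    = {b1, b2}. The terms in - T remove the last contribution when b1 = b2, so that the case
    distinction becomes a polynomial in deltas that can be summed. *)
Lemma quad_sum_ind_bound b1 b2 b3 b4 : `|quad_sum ind ind b1 b2 b3 b4| <=
  delta b1 b2 * delta b3 b4 * (n - T) + delta b1 b2 * T
  + (delta b1 b3 * delta b2 b4 * T + delta b1 b4 * delta b3 b2 * T)
  + (delta b1 b2 * delta b1 b3 * delta b2 b4 * - T
     + delta b1 b2 * delta b1 b4 * delta b3 b2 * - T) + 3 * sq.
Proof.
have sq3 : 0 <= 3 * sq by rewrite mulr_ge0 ?ler0n.
have Wle := quad_sum_ind_le b1 b2 b3 b4; set W := `|_| in Wle *.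
have WT : b3 != b4 -> W <= T by move=> b34; apply: le_trans Wle (T_pair b34).
have le_of_eq (x y : algC) : x = y -> x <= y by move=> ->.
rewrite /delta; have [b12|b12] := eqVneq b1 b2.
  apply: (@le_trans _ _ ((b3 == b4)%:R * (n - T) + T + 3 * sq)); last first.
    by apply: le_of_eq; rewrite b12 [b3 == b2]eq_sym !mul1r; ring.
  rewrite ler_wpDr //; have [b34|b34] := eqVneq b3 b4; last by rewrite mul0r add0r WT.
  rewrite mul1r subrK; apply: (le_trans Wle); rewrite b34 (reindex_inj (addIr (- b4))) /=.
  rewrite /n; apply: ler_sum => x _; rewrite subrK ler_piMl ?ind_ge0 ?ind_le1 //.
apply: (@le_trans _ _ (((b1 == b3)%:R * (b2 == b4)%:R + (b1 == b4)%:R * (b3 == b2)%:R) * T + 3 * sq)); last first.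
  by apply: le_of_eq; rewrite !mul0r; ring.
have triv (d : algC) : b3 != b4 -> 1 <= d -> W <= d * T + 3 * sq.
  by move=> b34 d1; apply: le_trans (WT b34) _; rewrite ler_wpDr // ler_peMl.
have nn (x y : bool) : 0 <= x%:R * y%:R :> algC by rewrite mulr_ge0 ?ler0n.
have [b1324|n1324] := boolP ((b1 == b3) && (b2 == b4)).
  have b34 : b3 != b4 by case/andP: b1324 => /eqP <- /eqP <-.
  by case/andP: b1324 => -> ->; apply: triv; rewrite // mulr1 lerDl.
have [b1432|n1432] := boolP ((b1 == b4) && (b3 == b2)).
  have b34 : b3 != b4 by case/andP: b1432 => /eqP <- /eqP ->; rewrite eq_sym.
  by case/andP: b1432 => -> ->; apply: triv; rewrite // mulr1 lerDr.
rewrite ler_wpDl ?mulr_ge0 ?addr_ge0 //; apply: quad_sum_ind_weil => //.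
have [b13|b13] := eqVneq b1 b3.
  by move: n1324 b12; rewrite b13 eqxx /= eq_sym => -> /=; rewrite eq_sym => ->.
have [b14|b14] := eqVneq b1 b4; last by [].
by move: n1432 b12; rewrite b14 eqxx /= eq_sym => -> /=; rewrite eq_sym => ->.
Qed.

Lemma mixed_moment : (#|A| * m ^ 4)%:R <=
  (m ^ 2)%:R * n + ((m ^ 3)%:R - (m ^ 2)%:R + 2 * ((m ^ 2)%:R - m%:R)) * T
  + (3 * m ^ 4)%:R * sq.
Proof.
set Q := sum4 (quad_sum ind ind).
have lo : (#|A| * m ^ 4)%:R <= Q.
  rewrite /Q sum4_quad natrM; apply: sum_over_A => [x|a aA].
    by rewrite mulr_ge0 ?exprn_ge0 // mulr_ge0 // sumr_ge0 // => b _; apply: ind_ge0.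
  have -> : \sum_(b in B) ind (a + b) = m%:R.
    by rewrite (eq_bigr (fun=> 1)) ?sumr_const // => b bB; rewrite /ind AB // eqxx.
  by rewrite fA // normr_nat -!natrX -!natrM; congr _%:R; ring.
apply: (le_trans lo); rewrite -[Q]ger0_norm; last by apply: (le_trans _ lo); rewrite ler0n.
apply: le_trans (norm_sum4 _) _.
apply: le_trans (le_sum4 quad_sum_ind_bound) _.
rewrite !(sum4D, sum4Z) sum4_const sum4_12 sum4_12_34 sum4_13_24 sum4_14_32.
rewrite sum4_12_13_24 sum4_12_14_32.
have -> : (3 * m ^ 4)%:R = 3 * (m ^ 4)%:R :> algC by rewrite natrM.
by rewrite le_eqVlt; apply/orP; left; apply/eqP; ring.
Qed.
End Mixed.

(** For k = 2 every nontrivial exponent is 1, so [weil_shift] bounds each of the eight terms, up to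
    its main term, by 2 sqrt q. The 3 accounts for the x at which some x + b_i vanishes. *)
Lemma triple_count b1 b2 b3 : k = 2%N -> b1 != b2 -> b1 != b3 -> b2 != b3 ->
  q%:R <= 3 + 8 * \sum_x ind (x + b1) * ind (x + b2) * ind (x + b3) + 16 * sq.
Proof.
move=> kE b12 b13 b23.
pose W (e1 e2 e3 : 'I_k) :=
  \sum_x chi (x + b1) ^+ e1.+1 * chi (x + b2) ^+ e2.+1 * chi (x + b3) ^+ e3.+1.
have WE : 8 * \sum_x ind (x + b1) * ind (x + b2) * ind (x + b3) =
    \sum_(e1 < k) \sum_(e2 < k) \sum_(e3 < k) W e1 e2 e3.
  rewrite mulr_sumr (eq_bigr (fun x => \sum_(e1 < k) \sum_(e2 < k) \sum_(e3 < k)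
      chi (x + b1) ^+ e1.+1 * chi (x + b2) ^+ e2.+1 * chi (x + b3) ^+ e3.+1)).
    rewrite exchange_big; apply: eq_bigr => e1 _; rewrite exchange_big.
    by apply: eq_bigr => e2 _; rewrite exchange_big.
  move=> x _; transitivity ((k%:R * ind (x + b1)) * (k%:R * ind (x + b2)) * (k%:R * ind (x + b3))).
    by rewrite kE; ring.
  rewrite !indE -mulrA mulr_suml; apply: eq_bigr => e1 _.
  rewrite mulr_suml mulr_sumr; apply: eq_bigr => e2 _.
  by rewrite !mulr_sumr; apply: eq_bigr => e3 _; rewrite mulrA.
pose W0 := \sum_x chi (x + b1) ^+ k * chi (x + b2) ^+ k * chi (x + b3) ^+ k.
pose L (e : 'I_k) : algC := (e.+1 == k)%:R.
have W0E : W0 = \sum_(e1 < k) \sum_(e2 < k) \sum_(e3 < k) L e1 * (L e2 * (L e3 * W0)).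
  rewrite (eq_bigr (fun e1 => L e1 * W0)) => [|e1 _]; first by rewrite -mulr_suml sum_last_ord mul1r.
  rewrite (eq_bigr (fun e2 => L e1 * (L e2 * W0))) => [|e2 _].
    by rewrite -mulr_sumr -mulr_suml sum_last_ord mul1r.
  by rewrite -!mulr_sumr -mulr_suml sum_last_ord mul1r.
have sq2 : 0 <= sq *+ 2 by rewrite mulrn_wge0.
have small (e : 'I_k) : e.+1 != k -> e.+1 = 1%N.
  by move: (nat_of_ord e) (ltn_ord e) => i; rewrite kE; case: i => [|[]].
have diff e1 e2 e3 : `|W e1 e2 e3 - L e1 * (L e2 * (L e3 * W0))| <= sq *+ 2.
  rewrite /L; have [e1k|/small e11] := eqVneq e1.+1 k; last first.
    rewrite mul0r subr0 /W e11.
    have := @weil_shift F k chi k2 kq chiP b1 [:: (b2, e2.+1); (b3, e3.+1)].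
    rewrite !inE negb_or b12 b13 => /(_ isT); congr (_ <= _); congr Num.norm.
    by apply: eq_bigr => x _; rewrite !big_cons big_nil mulr1 mulrA.
  have [e2k|/small e21] := eqVneq e2.+1 k; last first.
    rewrite mul0r mulr0 subr0 /W e21.
    have := @weil_shift F k chi k2 kq chiP b2 [:: (b1, e1.+1); (b3, e3.+1)].
    rewrite !inE negb_or eq_sym b12 b23 => /(_ isT); congr (_ <= _); congr Num.norm.
    by apply: eq_bigr => x _; rewrite !big_cons big_nil mulr1 mulrCA mulrA.
  have [e3k|/small e31] := eqVneq e3.+1 k; last first.
    rewrite mul0r !mulr0 subr0 /W e31.
    have := @weil_shift F k chi k2 kq chiP b3 [:: (b1, e1.+1); (b2, e2.+1)].
    rewrite !inE negb_or eq_sym b13 eq_sym b23 => /(_ isT); congr (_ <= _); congr Num.norm.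
    by apply: eq_bigr => x _; rewrite !big_cons big_nil mulr1 mulrC.
  by rewrite !mul1r /W e1k e2k e3k subrr normr0.
have chik (y : F) : chi y ^+ k = (y != 0)%:R.
  have [->|y0] := eqVneq y 0; first by rewrite (pchi0 chiP) expr0n eqn0Ngt k0.
  exact: (chi_unity kq chiP).
have W0ge : q%:R - 3 <= W0.
  have hit (b : F) : \sum_x (x + b == 0)%:R = 1 :> algC.
    rewrite (bigD1 (- b)) //= addNr eqxx big1 ?addr0 // => x xb.
    by rewrite addr_eq0 (negPf xb).
  apply: (@le_trans _ _ (\sum_x (1 - (x + b1 == 0)%:R - (x + b2 == 0)%:R - (x + b3 == 0)%:R))).
    by rewrite !sumrB !hit sumr_const -!addrA -!opprD.
  apply: ler_sum => x _; rewrite !chik.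
  case: (x + b1 == 0); case: (x + b2 == 0); case: (x + b3 == 0) => /=;
    rewrite ?mulr1 ?mul0r ?mulr0 ?subr0 ?subrr ?sub0r -?opprD ?oppr_le0 ?addr_ge0 //.
have W0r : W0 \is Num.real.
  by rewrite /W0 rpred_sum // => x _; rewrite !chik !rpredM ?realn.
have Xr : 8 * \sum_x ind (x + b1) * ind (x + b2) * ind (x + b3) \is Num.real.
  by rewrite rpredM ?realn // rpred_sum // => x _; rewrite !rpredM // realn.
have : `|W0 - 8 * \sum_x ind (x + b1) * ind (x + b2) * ind (x + b3)| <= 16 * sq.
  rewrite distrC WE W0E -sumrB.
  apply: le_trans (_ : \sum_(e1 < k) \sum_(e2 < k) \sum_(e3 < k) sq *+ 2 <= _); last first.
    by rewrite !sumr_const !card_ord kE -!mulrnA mulr_natl.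
  apply: le_trans (ler_norm_sum _ _ _) (ler_sum _ _) => e1 _; rewrite -sumrB.
  apply: le_trans (ler_norm_sum _ _ _) (ler_sum _ _) => e2 _; rewrite -sumrB.
  by apply: le_trans (ler_norm_sum _ _ _) (ler_sum _ _) => e3 _.
move=> dW; have := le_trans (real_ler_norm (rpredB W0r Xr)) dW.
rewrite lerBlDr => W0le; have := le_trans W0ge W0le.
by rewrite lerBlDr [_ + 3]addrC [16 * sq + _]addrC addrA.
Qed.
End Moments.

(** * The Hanson-Petridis bound *)

Lemma coef_addC_exp (R : comNzRingType) (c : R) n j :
  ((c%:P + 'X) ^+ n)`_j = (c ^+ (n - j)) *+ 'C(n, j).
Proof.
rewrite exprDn coef_sum; have [jn|nj] := ltnP j n.+1; last first.
  rewrite bin_small // mulr0n big1 // => i _.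
  rewrite -polyC_exp coefMn coefCM coefXn gtn_eqF ?mulr0 ?mul0rn //.
  exact: leq_trans (ltn_ord i) nj.
rewrite (bigD1 (Ordinal jn)) //= big1 ?addr0 => [|i ij].
  by rewrite -polyC_exp coefMn coefCM coefXn eqxx mulr1.
rewrite -polyC_exp coefMn coefCM coefXn; case: eqP => [jE|]; last by rewrite mulr0 mul0rn.
by case/eqP: ij; apply: val_inj.
Qed.

Lemma prod_XsubC_exp_dvd (F : fieldType) (s : seq F) m (G : {poly F}) : uniq s ->
  (forall a, a \in s -> ('X - a%:P) ^+ m %| G) -> \prod_(a <- s) ('X - a%:P) ^+ m %| G.
Proof.
elim: s => [|a s IHs] /=; first by rewrite big_nil dvd1p.
case/andP=> as_ us sG; rewrite big_cons Gauss_dvdp.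
  rewrite sG ?mem_head //=; apply: IHs => // b bs.
  by rewrite sG // in_cons bs orbT.
rewrite big_seq; apply: (big_ind (coprimep (('X - a%:P) ^+ m))) => [|p r|b bs].
- exact: coprimep1.
- by rewrite coprimepMr => -> ->.
apply/coprimep_expl/coprimep_expr/coprimep_XsubC2.
by rewrite subr_eq0; apply: contraNneq as_ => <-.
Qed.

(** The order of vanishing is read from the Taylor expansion at a, since iterated derivatives lose
    information in positive characteristic. *)
Lemma exp_XsubC_dvd (F : fieldType) (G : {poly F}) (a : F) m :
  (forall j, (j < m)%N -> (G \Po (a%:P + 'X))`_j = 0) -> ('X - a%:P) ^+ m %| G.
Proof.
move=> G0; have GE : G \Po (a%:P + 'X) = drop_poly m (G \Po (a%:P + 'X)) * 'X^m.
  rewrite -{1}(poly_take_drop m (G \Po (a%:P + 'X))) [take_poly _ _](_ : _ = 0) ?add0r //.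
  by apply/polyP => j; rewrite coef_take_poly coef0; case: ifP => // /G0.
have -> : G = (G \Po (a%:P + 'X)) \Po ('X - a%:P).
  by rewrite -comp_polyA comp_polyD comp_polyC comp_polyX addrC subrK comp_polyXr.
by rewrite GE comp_polyM rmorphXn /= comp_polyX dvdp_mull.
Qed.

Section HansonPetridis.
Variable F : finFieldType.
Variable B : {set F}.
Local Notation m := #|B|.

(** Weights of the divided difference over [B]: they extract the top coefficient of the Lagrange
    interpolant. *)
Definition divdiff_weight (b : F) : F := (\prod_(c in B :\ b) (b - c))^-1.

Lemma divided_difference (g : {poly F}) : (size g <= m)%N ->
  \sum_(b in B) divdiff_weight b * g.[b] = g`_m.-1.
Proof.
move=> gm; pose l b : {poly F} := \prod_(c in B :\ b) ('X - c%:P).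
have cardB1 b : b \in B -> #|B :\ b| = m.-1 by move=> bB; rewrite (cardsD1 b B) bB.
have m0 b : b \in B -> m = m.-1.+1 by move=> bB; rewrite prednK // card_gt0; apply/set0Pn; exists b.
have lsz b : b \in B -> size (l b) = m.
  by move=> bB; rewrite /l -big_enum size_prod_XsubC -cardE cardB1 // -(m0 b bB).
have lmon b : l b \is monic by rewrite /l monic_prod // => c _; apply: monicXsubC.
have lE b : (l b).[b] = (divdiff_weight b)^-1.
  rewrite invrK /l horner_prod; apply: eq_bigr => c _; exact: hornerXsubC.
have l0 b c : b \in B -> c \in B -> c != b -> (l b).[c] = 0.
  move=> bB cB cb; rewrite /l horner_prod (bigD1 c) ?in_setD1 ?cb //=.
  by rewrite hornerXsubC subrr mul0r.
have w0 b : divdiff_weight b != 0.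
  rewrite invr_eq0; apply/prodf_neq0 => c; rewrite in_setD1 subr_eq0 eq_sym.
  by case/andP.
pose G := \sum_(b in B) (divdiff_weight b * g.[b]) *: l b.
have gG : g = G.
  apply/eqP; rewrite -subr_eq0; apply/negPn/negP => nz.
  have := max_poly_roots nz (rs := enum B); rewrite enum_uniq -cardE.
  have -> : all (root (g - G)) (enum B).
    apply/allP => c; rewrite mem_enum => cB.
    rewrite /root hornerD hornerN horner_sum (bigD1 c) //= big1 ?addr0 => [|b /andP[bB bc]].
      by rewrite hornerZ lE mulrAC mulfV // mul1r subrr.
    by rewrite hornerZ l0 ?mulr0 // eq_sym.
  move=> /(_ isT isT); rewrite ltnNge; case/negP.
  apply: leq_trans (size_polyD _ _) _; rewrite geq_max gm size_polyN.
  apply: leq_trans (size_sum _ _ _) _; apply/bigmax_leqP => b bB.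
  by apply: leq_trans (size_scale_leq _ _) _; rewrite lsz.
rewrite [in RHS]gG coef_sum; apply: eq_bigr => b bB.
rewrite coefZ -[LHS]mulr1; congr (_ * _).
by have /monicP := lmon b; rewrite lead_coefE lsz // => ->.
Qed.

(** [G] is the divided difference over b in [B] of (b + X)^L, minus 1. In its Taylor coefficients at
    a in [A] of order j < m, (a + b)^n = 1 lowers the power of a + b to m - 1 - j: the divided
    difference is 0 for j > 0 and cancels the 1 for j = 0. So [G] vanishes to order m on [A], and
    the binomial hypothesis makes its degree exactly n. *)
Theorem hanson_petridis (A : {set F}) n : (0 < n)%N -> (0 < m)%N ->
  ('C(n + m.-1, n)%:R : F) != 0 ->
  (forall a b, a \in A -> b \in B -> (a + b) ^+ n = 1) ->
  (#|A| * m <= n)%N.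
Proof.
move=> n0 m0 C0 AB; set L := (n + m.-1)%N in C0.
pose G : {poly F} := \sum_(b in B) divdiff_weight b *: (b%:P + 'X) ^+ L - 1.
have G_shift a : G \Po (a%:P + 'X) =
    \sum_(b in B) divdiff_weight b *: ((a + b)%:P + 'X) ^+ L - 1.
  rewrite /G rmorphB rmorph1 rmorph_sum; congr (_ - _); apply: eq_bigr => b _.
  rewrite /= comp_polyZ rmorphXn /= comp_polyD comp_polyC comp_polyX.
  by rewrite addrA -polyCD [b + a]addrC.
have G_coef a j : (G \Po (a%:P + 'X))`_j =
    (\sum_(b in B) divdiff_weight b * (a + b) ^+ (L - j)) *+ 'C(L, j) - (j == 0)%:R.
  rewrite G_shift coefB coef1 coef_sum; congr (_ - _); rewrite -sumrMnl.
  by apply: eq_bigr => b _; rewrite coefZ coef_addC_exp mulrnAr.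
have G_vanish a : a \in A -> forall j, (j < m)%N -> (G \Po (a%:P + 'X))`_j = 0.
  move=> aA j jm; rewrite G_coef.
  have -> : \sum_(b in B) divdiff_weight b * (a + b) ^+ (L - j) =
            \sum_(b in B) divdiff_weight b * ((a%:P + 'X) ^+ (m.-1 - j)).[b].
    apply: eq_bigr => b bB; congr (_ * _); rewrite !hornerE.
    have -> : (L - j = n + (m.-1 - j))%N by rewrite /L addnBA // -ltnS prednK.
    by rewrite exprD AB // mul1r.
  have jm1 : (j <= m.-1)%N by rewrite -ltnS prednK.
  rewrite divided_difference.
    rewrite coef_addC_exp; case: j {jm} jm1 => [|j] jm1.
      by rewrite subn0 subnn expr0 !binn bin0 subrr.
    by rewrite [X in _ *+ X *+ _]bin_small ?mul0rn ?subrr // ltn_subrL; lia.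
  apply: leq_trans (_ : (m.-1 - j).+1 <= m)%N; last by rewrite -ltnS; lia.
  rewrite [_ + 'X]addrC; have := size_exp ('X + a%:P) (m.-1 - j).
  rewrite size_XaddC mul1n => sE.
  rewrite -[X in (_ <= X.+1)%N]sE; exact: leqSpred.
have G0E : G = G \Po (0%:P + 'X) by rewrite polyC0 add0r comp_polyXr.
(* For j >= n the power L - j is at most m - 1, so its divided difference is 1 for j = n and 0
   beyond. *)
have G_top j : (n <= j)%N -> G`_j = (j == n)%:R *+ 'C(L, j).
  move=> nj; rewrite [in LHS]G0E G_coef [(j == 0)%N]gtn_eqF ?(leq_trans n0) // subr0.
  have [Lj|jL] := ltnP L j; first by rewrite !bin_small.
  congr (_ *+ _).
  have -> : \sum_(b in B) divdiff_weight b * (0 + b) ^+ (L - j) =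
            \sum_(b in B) divdiff_weight b * ('X^(L - j)).[b].
    by apply: eq_bigr => b _; rewrite add0r hornerXn.
  rewrite divided_difference ?coefXn ?size_polyXn; last by rewrite /L; lia.
  by congr (_%:R); congr nat_of_bool; apply/eqP/eqP; rewrite /L; lia.
have Gsz : size G = n.+1.
  apply/eqP; rewrite eqn_leq; apply/andP; split.
    by apply/leq_sizeP => j nj; rewrite G_top 1?ltnW // gtn_eqF // mul0rn.
  rewrite ltnNge; apply/negP => /leq_sizeP /(_ n (leqnn n)).
  by rewrite G_top // eqxx => /eqP; rewrite (negPf C0).
have Gdvd : \prod_(a <- enum A) ('X - a%:P) ^+ m %| G.
  apply: prod_XsubC_exp_dvd; first exact: enum_uniq.
  by move=> a; rewrite mem_enum => aA; apply: exp_XsubC_dvd; apply: G_vanish.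
have := dvdp_leq _ Gdvd; rewrite -size_poly_gt0 Gsz => /(_ isT).
rewrite prodrXl => sz; have := size_exp (\prod_(a <- enum A) ('X - a%:P)) m.
rewrite size_prod_XsubC -cardE /= => <-.
by rewrite -ltnS (leq_trans _ sz) // prednK // size_poly_gt0 expf_neq0 // monic_neq0 // monic_prod_XsubC.
Qed.
End HansonPetridis.

(** * Additive decompositions of the set of kth powers *)

(** Unless a <= b, both inequalities say (a - b)^2 <= c^2 p, a statement about natural numbers. *)
Lemma sqrt_transfer (R : rcfType) (a b c p : nat) :
  (a%:R : algC) <= b%:R + c%:R * sqrtC p%:R ->
  (a%:R : R) <= b%:R + c%:R * Num.sqrt p%:R.
Proof.
have sC : 0 <= sqrtC p%:R :> algC by rewrite sqrtC_ge0 ler0n.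
have sR : 0 <= Num.sqrt p%:R :> R by apply: sqrtr_ge0.
have [ab _|ba abc] := leqP a b.
  by rewrite ler_wpDr ?mulr_ge0 ?ler0n // ler_nat.
have : ((a - b) ^ 2 <= c ^ 2 * p)%N.
  rewrite -(ler_nat algC) natrM !natrX -(sqrtCK (p%:R : algC)) -exprMn.
  by rewrite ler_pXn2r ?nnegrE ?mulr_ge0 ?ler0n // natrB ?(ltnW ba) // lerBlDl.
set s := Num.sqrt _ in sR *; have s2 : p%:R = s ^+ 2 by rewrite sqr_sqrtr ?ler0n.
rewrite -(ler_nat R) natrM !natrX s2 -exprMn.
by rewrite ler_pXn2r ?nnegrE ?mulr_ge0 ?ler0n // natrB ?(ltnW ba) // lerBlDl.
Qed.

Section Tiling.
Variables (F : finFieldType) (k : nat) (chi : F -> algC).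
Local Notation q := #|F|.
Local Notation sq := (sqrtC (q%:R : algC)).
Hypotheses (k2 : (2 <= k)%N) (kq : (k %| q.-1)%N) (chiP : power_char k chi).
Variables A B : {set F}.
Local Notation N := #|A|.
Local Notation m := #|B|.
Hypothesis AB : forall a b, a \in A -> b \in B -> chi (a + b) = 1.
Hypothesis cardAB : (k * (N * m) = q.-1)%N.

Let k0 : (0 < k)%N. Proof. exact: ltnW. Qed.

Lemma tile_mixed : (k ^ 2 * (N * m ^ 4))%:R <=
  (k ^ 2 * (m ^ 2 * (N * m)) + (m * m.-1 * m.+2) * q)%:R
  + (k ^ 2 * (m * m.-1 * m.+2 + 3 * m ^ 4))%:R * sq.
Proof.
have kk0 : 0 < (k ^ 2)%:R :> algC by rewrite ltr0n expn_gt0 k0.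
pose T : algC := (q%:R + (k ^ 2)%:R * sq) / (k ^ 2)%:R.
have T0 : 0 <= T.
  by rewrite divr_ge0 ?ler0n // addr_ge0 ?mulr_ge0 ?ler0n // sqrtC_ge0 ler0n.
have Tp b1 b2 : b1 != b2 -> \sum_x ind chi (x + b1) * ind chi (x + b2) <= T.
  by move=> b12; rewrite ler_pdivlMr // mulrC; apply: (pair_count k2 kq chiP b12).
have nE : \sum_x ind chi x = (N * m)%:R.
  have kn0 : k%:R != 0 :> algC by rewrite pnatr_eq0 -lt0n.
  by apply: (mulfI kn0); rewrite (sum_ind k2 kq chiP) -natrM cardAB.
have := mixed_moment k2 kq chiP AB T0 Tp; rewrite nE.
rewrite -(ler_pM2l kk0) => h; rewrite natrM; apply: (le_trans h).
have cE : (m ^ 3)%:R - (m ^ 2)%:R + 2 * ((m ^ 2)%:R - m%:R) = (m * m.-1 * m.+2)%:R :> algC.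
  case: (m) => [|u]; first by rewrite !mul0n !exp0n // !subrr mulr0 addr0.
  by rewrite /=; ring.
rewrite cE le_eqVlt; apply/orP; left; apply/eqP.
rewrite /T; rewrite !natrM !natrD !natrM; field.
by rewrite pnatr_eq0 -lt0n.
Qed.

Hypothesis sum_inj : forall a b a' b', a \in A -> b \in B -> a' \in A -> b' \in B ->
  a + b = a' + b' -> a = a'.

Lemma card_setE (X : {set F}) : #|X|%:R = \sum_x (x \in X)%:R :> algC.
Proof. by rewrite -sum1_card natr_sum big_mkcond; apply: eq_bigr => x _; case: (x \in X). Qed.

(** [A] lies in X, the x with x + b1 and x + b2 squares, and both have about q/4 elements. By
    uniqueness of sums a and a + c are never both in [A], so every x of X3 has x or x + c in X \ A;
    hence |X3| <= 2 (|X| - N) is O(sqrt q), although [triple_count] makes it about q/8. *)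
Lemma tile_two_two : k = 2%N -> m = 2%N -> (2%:R : F) != 0 ->
  (q%:R : algC) <= 7%:R + 32%:R * sq.
Proof.
move=> kE mE two0.
have /cards2P[b1 [b2 [b12 BE]]] : m == 2%N by rewrite mE.
have b1B : b1 \in B by rewrite BE !inE eqxx.
have b2B : b2 \in B by rewrite BE !inE eqxx orbT.
pose c := b2 - b1; pose b3 := b2 + c.
have c0 : c != 0 by rewrite subr_eq0 eq_sym.
have b1c : b1 + c = b2 by rewrite addrC subrK.
have b23 : b2 != b3 by rewrite /b3 eq_sym -subr_eq0 addrC addKr.
have b13 : b1 != b3.
  have -> : b3 = b1 + 2%:R * c by rewrite /b3 -b1c; ring.
  by rewrite eq_sym -subr_eq0 addrC addKr mulf_neq0.
pose X := [set x | (chi (x + b1) == 1) && (chi (x + b2) == 1)].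
pose X3 := [set x | [&& chi (x + b1) == 1, chi (x + b2) == 1 & chi (x + b3) == 1]].
have AX : A \subset X.
  by apply/subsetP => a aA; rewrite inE !AB ?eqxx.
have X3sub : X3 \subset (X :\: A) :|: [set x - c | x in X :\: A].
  apply/subsetP => x; rewrite inE => /and3P[x1 x2 x3].
  rewrite in_setU in_setD [x \in X]inE x1 x2 andbT.
  have [xA|//] := boolP (x \in A); apply/imsetP; exists (x + c); last by rewrite addrK.
  rewrite in_setD; apply/andP; split; last first.
    have e1 : x + c + b1 = x + b2 by rewrite addrAC -addrA b1c.
    have e2 : x + c + b2 = x + b3 by rewrite /b3 addrAC -addrA.
    by rewrite inE e1 e2 x2 x3.
  apply/negP => xcA; have := sum_inj xA b2B xcA b1B.
  rewrite -b1c addrA addrAC => /(_ erefl) /eqP.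
  by rewrite -{1}[x]addr0 (inj_eq (addrI x)) eq_sym (negPf c0).
have X3le : (#|X3| <= 2 * (#|X| - N))%N.
  apply: leq_trans (subset_leq_card X3sub) _; rewrite -(cardsDS AX) mul2n -addnn.
  apply: leq_trans (leq_card_setU _ _) _; rewrite leq_add2l; exact: leq_imset_card.
have XN : (N <= #|X|)%N by apply: subset_leq_card.
have sq0 : 0 <= sq by rewrite sqrtC_ge0 ler0n.
have Xc : 4%:R * #|X|%:R <= q%:R + 4%:R * sq.
  have := pair_count k2 kq chiP b12; rewrite {1 2}kE; congr (_ * _ <= _).
  rewrite card_setE; apply: eq_bigr => x _; rewrite /ind inE.
  by rewrite -natrM mulnb.
have X3c : q%:R <= 3 + 8 * #|X3|%:R + 16 * sq.
  have := triple_count k2 kq chiP kE b12 b13 b23; congr (_ <= _ + _ * _ + _).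
  rewrite card_setE; apply: eq_bigr => x _; rewrite /ind inE.
  by rewrite -!natrM !mulnb -andbA.
have N4 : 4%:R * N%:R = q%:R - 1 :> algC.
  have q0 : (0 < q)%N by apply: ltnW; apply: finNzRing_gt1.
  have N4 : (4 * N = q.-1)%N by rewrite -cardAB kE mE [(N * 2)%N]mulnC mulnA.
  rewrite -natrM N4 -[in RHS](prednK q0) -natr1 addrK //.
apply: (le_trans X3c).
have X3r : 8 * #|X3|%:R <= 4 * (4%:R * #|X|%:R - 4%:R * N%:R) :> algC.
  rewrite -mulrBr -natrB // -!natrM ler_nat.
  by apply: leq_trans (leq_mul (leqnn 8) X3le) _; rewrite !mulnA.
rewrite -lerBrDr -lerBrDl; apply: (le_trans X3r); rewrite N4.
apply: le_trans (ler_wpM2l _ (lerB Xc (lexx _))) _; first by rewrite ler0n.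
by rewrite le_eqVlt; apply/orP; left; apply/eqP; ring.
Qed.
End Tiling.

Lemma prime_bin_nondvd p L n : prime p -> (L < p)%N -> (n <= L)%N -> ~~ (p %| 'C(L, n))%N.
Proof.
move=> p_pr Lp nL; have pL : ~~ (p %| L`!)%N.
  elim: L Lp {nL} => [|L IHL] Lp; first by rewrite fact0 dvdn1 gtn_eqF ?prime_gt1.
  by rewrite factS Euclid_dvdM // negb_or IHL ?(ltnW Lp) // gtnNdvd.
by apply: contra pL => pC; rewrite -(bin_fact nL) dvdn_mulr.
Qed.

Lemma mixed_moment_arith (R : realFieldType) (x y z s : R) :
  0 < y -> 0 <= s -> x * z * y = s ^+ 2 - 1 ->
  x * x * (z * (y * (y * (y * y)))) <= x * x * (y * y * (z * y))
    + y * (y - 1) * (y + 1 + 1) * s ^+ 2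
    + x * x * (y * (y - 1) * (y + 1 + 1) + 3 * (y * (y * (y * y)))) * s ->
  (s ^+ 2 - 1) * ((y - 1) * ((x - 1) * y - 2))
    <= y * (y + 1) + x * x * y * (3 * (y * y) + y + 1) * s.
Proof.
move=> y0 s0 sE; have -> : s ^+ 2 = x * z * y + 1 by rewrite sE subrK.
move=> E; rewrite addrK -(ler_pM2l y0) -subr_ge0.
have xys : 0 <= 2 * y * (1 + x ^+ 2 * s).
  have xs : 0 <= x ^+ 2 * s by rewrite mulr_ge0 ?sqr_ge0.
  by apply: mulr_ge0; [rewrite mulr_ge0 ?ler0n // ltW | rewrite addr_ge0].
move: E; rewrite -subr_ge0 => E; apply: le_trans (addr_ge0 E xys) _.
by rewrite le_eqVlt; apply/orP; left; apply/eqP; ring.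
Qed.

(** * Inequalities for the cardinalities over a prime field *)

Section PrimeTiling.
Variables (p k : nat).
Hypotheses (p_pr : prime p) (k2 : (2 <= k)%N) (pk : p = 1 %[mod k]).
Variables A B : {set 'F_p}.
Hypothesis tile : sumset A B = kth_powers p k.
Hypotheses (A2 : (2 <= #|A|)%N) (B2 : (2 <= #|B|)%N).
Local Notation N := #|A|.
Local Notation m := #|B|.

Let pF : #|'F_p| = p. Proof. exact: card_Fp. Qed.

Let kp : (k %| p.-1)%N.
Proof. by rewrite -subn1 -eqn_mod_dvd ?prime_gt0 //; apply/eqP. Qed.

Let kq : (k %| #|'F_p|.-1)%N. Proof. by rewrite pF. Qed.

Let k0 : (0 < k)%N. Proof. exact: ltnW. Qed.

Let kth_powersP (chi : 'F_p -> algC) :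
  (forall x, chi x == 1 <-> exists2 y, y != 0 & x = y ^+ k) ->
  forall x, (x \in kth_powers p k) = (chi x == 1).
Proof.
move=> chiD x; apply/imsetP/idP => [[y]|/chiD[y y0 ->]].
  by rewrite inE => y0 ->; apply/chiD; exists y.
by exists y; rewrite ?inE.
Qed.

Lemma card_kth_powers : (k * #|kth_powers p k| = p.-1)%N.
Proof.
have [chi chiP chiD] := exists_power_char k0 kq.
apply/eqP; rewrite -(eqr_nat algC) natrM -[in X in _ == X]pF -(sum_ind k2 kq chiP) card_setE.
by apply/eqP; congr (_ * _); apply: eq_bigr => x _; rewrite (kth_powersP chiD).
Qed.

(** Covering gives one inequality, [hanson_petridis] with n = |D_k| the other. A translate of [B]
    lies in D_k, so m <= n and n + m - 1 < 2n <= p - 1, which keeps the binomial coefficient nonzero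
    modulo p. *)
Lemma tile_card : (k * (N * m) = p.-1)%N.
Proof.
have [chi chiP chiD] := exists_power_char k0 kq.
have DE := kth_powersP chiD.
have sumD a b : a \in A -> b \in B -> a + b \in kth_powers p k.
  by move=> aA bB; rewrite -tile; apply/imset2P; exists a b.
have Dcard := card_kth_powers.
rewrite -Dcard; apply/eqP; rewrite eqn_pmul2l // eqn_leq; apply/andP; split; last first.
  by rewrite -tile /sumset curry_imset2X; apply: leq_trans (leq_imset_card _ _) _; rewrite cardsX.
have DnE : #|kth_powers p k| = (p.-1 %/ k)%N by rewrite -Dcard mulKn.
have mD : (m <= #|kth_powers p k|)%N.
  have /card_gt0P[a aA] : (0 < N)%N by apply: ltnW.
  rewrite -(card_imset _ (addrI a)); apply: subset_leq_card.
  by apply/subsetP => _ /imsetP[b bB ->]; apply: sumD.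
have D0 : (0 < #|kth_powers p k|)%N by apply: leq_trans mD; apply: ltnW.
apply: (hanson_petridis D0); first exact: ltnW.
  rewrite -(dvdn_pcharf (pchar_Fp p_pr)); apply: prime_bin_nondvd => //; last exact: leq_addr.
  have : (2 * #|kth_powers p k| <= p.-1)%N by rewrite -Dcard leq_mul2r k2 orbT.
  move=> d2; apply: (@leq_trans (2 * #|kth_powers p k|)); last first.
    exact: leq_trans d2 (leq_pred p).
  by rewrite mul2n -addnn ltn_add2l prednK // ltnW.
move=> a b /sumD ab /ab; rewrite DE DnE => ab1; apply/eqP.
have ab0 : a + b != 0 by rewrite -(chi_neq0 chiP) (eqP ab1) oner_eq0.
by have := pchiE chiP ab0; rewrite ab1 pF => <-.
Qed.

Lemma tile_inj a b a' b' : a \in A -> b \in B -> a' \in A -> b' \in B ->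
  a + b = a' + b' -> a = a'.
Proof.
have : #|[set u.1 + u.2 | u in setX A B]| == #|setX A B|.
  have -> : [set u.1 + u.2 | u in setX A B] = kth_powers p k.
    by rewrite -tile /sumset curry_imset2X; apply: eq_imset => -[].
  by rewrite cardsX -(eqn_pmul2l k0) tile_card card_kth_powers.
move/imset_injP => inj aA bB a'A b'B ab.
have := inj (a, b) (a', b'); rewrite !in_setX aA bB a'A b'B.
by move=> /(_ isT isT ab) [].
Qed.
Lemma tile_inequalities (R : rcfType) (s := Num.sqrt p%:R : R) :
  [/\ k%:R * N%:R * m%:R = s ^+ 2 - 1,
      N%:R * m%:R * (m%:R - 3 * k%:R) <= 3 + 3 * m%:R ^+ 2 * s
    & (2 < p)%N -> [/\ k = 2%N, m = 2%N & s <= 33] \/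
      (0 < m.-1 * (k.-1 * m - 2))%N /\
      (s ^+ 2 - 1) * (m.-1 * (k.-1 * m - 2))%:R
        <= (m * m.+1)%:R + (k ^ 2 * m * (3 * m ^ 2 + m + 1))%:R * s].
Proof.
have s2 : s ^+ 2 = p%:R by rewrite sqr_sqrtr ?ler0n.
have s0 : 0 <= s by apply: sqrtr_ge0.
have [chi chiP chiD] := exists_power_char k0 kq.
have AB a b : a \in A -> b \in B -> chi (a + b) = 1.
  move=> aA bB; apply/eqP; rewrite -(kth_powersP chiD) -tile.
  by apply/imset2P; exists a b.
have cardE : k%:R * N%:R * m%:R = s ^+ 2 - 1.
  have pE : p%:R = p.-1%:R + 1 :> R by rewrite natr1 prednK ?prime_gt0.
  by rewrite s2 pE addrK -tile_card !natrM mulrA.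
have m0 : 0 < m%:R :> R by rewrite ltr0n ltnW.
have k0R : 0 < k%:R :> R by rewrite ltr0n.
have N0 : 0 < N%:R :> R by rewrite ltr0n ltnW.
split => //.
  have := fourth_moment k2 kq chiP AB; rewrite pF => /(@sqrt_transfer R).
  rewrite -/s !natrM -s2 => E1.
  (* The fourth moment divided by m^2; writing p = k N m + 1 then turns 3p into 3k N m + 3. *)
  have : N%:R * m%:R ^+ 2 <= 3 * s ^+ 2 + 3 * m%:R ^+ 2 * s.
    rewrite -(ler_pM2r (exprn_gt0 2 m0)); apply: le_trans (le_trans _ E1) _.
      by rewrite le_eqVlt; apply/orP; left; apply/eqP; ring.
    by rewrite le_eqVlt; apply/orP; left; apply/eqP; ring.
  have -> : s ^+ 2 = k%:R * N%:R * m%:R + 1 by rewrite cardE subrK.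
  by nra.
move=> p2.
have [[kE mE]|nkm] : (k = 2%N /\ m = 2%N) \/ (0 < m.-1 * (k.-1 * m - 2))%N.
  have [mE|m2] := eqVneq m 2%N; last first.
    by right; rewrite muln_gt0 -!subn1 !subn_gt0; move: m2 k2 B2; rewrite mulnBl mul1n; nia.
  have [kE|k2'] := eqVneq k 2%N; first by left.
  by right; move: k2' k2; rewrite mE; lia.
- left; split => //.
  have two0 : (2%:R : 'F_p) != 0.
    rewrite -(dvdn_pcharf (pchar_Fp p_pr)); apply/negP => /dvdn_leq; lia.
  have tile' : (k * (N * m) = #|'F_p|.-1)%N by rewrite pF tile_card.
  have := tile_two_two k2 kq chiP AB tile' tile_inj kE mE two0.
  rewrite pF -[X in X <= _]/(p%:R) => /(@sqrt_transfer R p 7 32); rewrite -/s -s2.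
  by nra.
right; split => //.
have tile' : (k * (N * m) = #|'F_p|.-1)%N by rewrite pF tile_card.
have := tile_mixed k2 kq chiP AB tile'.
rewrite pF => /(@sqrt_transfer R); rewrite -/s.
have kD : k.-1%:R = k%:R - 1 :> R by rewrite -[in RHS](prednK k0) -natr1 addrK.
have m0' : (0 < m)%N by apply: ltnW.
have mD : m.-1%:R = m%:R - 1 :> R by rewrite -[in RHS](prednK m0') -natr1 addrK.
(* Makes the truncated subtraction [k.-1 * m - 2] a genuine one. *)
have km2 : (2 <= k.-1 * m)%N by move: k2 B2; case: (k) => [|[|l]] // _; rewrite mulSn; lia.
rewrite !(natrM, natrD, natrB _ km2) kD mD -[m.+2%:R]natr1 -[m.+1%:R]natr1 -s2 => E2.
exact: (mixed_moment_arith m0 s0 cardE E2).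
Qed.
End PrimeTiling.

Lemma sumsetC (V : finZmodType) (A B : {set V}) : sumset A B = sumset B A.
Proof.
by apply/setP => x; apply/imset2P/imset2P => -[a b aA bB ->]; exists b a; rewrite // addrC.
Qed.

(** Dividing the mixed-moment inequality by its left factor leaves p - 1 <= 6 + (90k^2 + 150k + 30)
    sqrt p, impossible for large p. *)
Lemma small_summand_arith k m : (2 <= k)%N -> (2 <= m <= 6 * k + 1)%N ->
  (0 < m.-1 * (k.-1 * m - 2))%N ->
  (m * m.+1 <= 6 * (m.-1 * (k.-1 * m - 2)))%N /\
  (k ^ 2 * m * (3 * m ^ 2 + m + 1)
     <= (90 * k ^ 2 + 150 * k + 30) * (m.-1 * (k.-1 * m - 2)))%N.
Proof.
move=> k2 /andP[m2 mk]; have [k3|] := leqP 3 k; last first.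
  move=> k3; have kE : k = 2%N by lia.
  subst k; move: m m2 mk.
  (* For k = 2 only m <= 13 remain, each settled by computation; m = 2 contradicts the positivity of
     the factor. *)
  by do 14![case=> //].
move=> _; set D := (m.-1 * _)%N.
have D4 : (k.-1 * m ^ 2 <= 4 * D)%N.
  have m1 : (m <= 2 * m.-1)%N by lia.
  have km : (k.-1 * m <= 2 * (k.-1 * m - 2))%N.
    have : (2 * 2 <= k.-1 * m)%N by apply: leq_mul => //; lia.
    by lia.
  by have := leq_mul m1 km; rewrite /D; nia.
have m15 : (4 * (3 * m ^ 2 + m + 1) <= 15 * m ^ 2)%N by nia.
split.
  rewrite -(leq_pmul2l (isT : 0 < 4)%N); apply: leq_trans (_ : 6 * (k.-1 * m ^ 2) <= _)%N; last first.
    by rewrite [leqRHS]mulnCA leq_mul2l D4 orbT.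
  by nia.
rewrite -(leq_pmul2l (isT : 0 < 4)%N) [leqRHS]mulnCA.
apply: leq_trans (_ : (90 * k ^ 2 + 150 * k + 30) * (k.-1 * m ^ 2) <= _)%N; last first.
  by rewrite leq_mul2l D4 orbT.
apply: leq_trans (_ : k ^ 2 * m * (15 * m ^ 2) <= _)%N.
  by rewrite [leqLHS]mulnCA leq_mul2l m15 orbT.
apply: leq_trans (_ : k ^ 2 * (6 * k + 1) * (15 * m ^ 2) <= _)%N.
  by rewrite leq_mul2r leq_mul2l mk !orbT.
rewrite [leqLHS]mulnCA [leqRHS]mulnA mulnA leq_mul2r; apply/orP; right.
(* The quadratic is chosen for 15 k^2 (6k + 1) <= (90k^2 + 150k + 30)(k - 1), valid from k = 3
   on. *)
by case: k k2 k3 {mk D D4} => // l _ l2 /=; clear -l2; nia.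
Qed.

(** * Real inequalities with k, m, N and sqrt p as x, y, z, s *)

Section Arithmetic.
Variable R : realFieldType.
Implicit Types x y z s : R.

Lemma large_summand_arith x y z s : 2 <= x -> 6 * x + 2 <= y -> 0 < z -> 10 <= s ->
  x * z * y = s ^+ 2 - 1 -> z * y * (y - 3 * x) <= 3 + 3 * y ^+ 2 * s ->
  z * s <= 6 * (s ^+ 2 - 1).
Proof.
move=> x2 xy z0 s10 E0 E1; rewrite leNgt; apply/negP => zs.
have y0 : 0 < y by lra.
have xy0 : 0 < x * y by rewrite mulr_gt0 //; lra.
have s21 : 0 < s ^+ 2 - 1 by nra.
(* Comparing z s > 6 (s^2 - 1) with x z y = s^2 - 1 gives s > 6 x y, and x >= 2. *)
have ys : 12 * y < s.
  have h : 6 * (x * y) < s.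
    have e : (s ^+ 2 - 1) * (s - 6 * (x * y)) = x * y * (z * s - 6 * (s ^+ 2 - 1)).
      have -> : (s ^+ 2 - 1) * (s - 6 * (x * y)) = x * z * y * s - 6 * (x * y) * (s ^+ 2 - 1).
        by rewrite E0; ring.
      by ring.
    rewrite -subr_gt0 -(pmulr_rgt0 _ s21) e mulr_gt0 //; lra.
  by nra.
have zy : 0 < z * y by rewrite mulr_gt0.
(* The threshold 6x + 2 is where y - 3x reaches (y + 2)/2; the surplus 2 is what contradicts s > 12
   y. *)
have E2 : z * y * (y + 2) <= 6 + 6 * y ^+ 2 * s by nra.
have s0 : 0 < s by lra.
have E3 : z * s * (y * (y + 2)) <= 6 * s + 6 * y ^+ 2 * s ^+ 2.
  have := ler_wpM2r (ltW s0) E2; nra.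
have yy : 0 < y * (y + 2) by rewrite mulr_gt0 //; lra.
have E4 : 6 * (s ^+ 2 - 1) * (y * (y + 2)) < 6 * s + 6 * y ^+ 2 * s ^+ 2.
  by apply: lt_le_trans E3; rewrite ltr_pM2r.
have E5 : 2 * y * s ^+ 2 - y ^+ 2 - 2 * y < s by nra.
by nra.
Qed.
Lemma quadratic_lt (s a b : R) : 0 <= a -> 0 <= b -> a + b + 2 <= s ->
  a + b * s < s ^+ 2 - 1.
Proof. by move=> a0 b0 abs; nra. Qed.

(** (1/3 - eps)(3 + eps) = 1 - (8/3) eps - eps^2, and since 1 <= eps s the term eps^2 s^2 absorbs
    the 1 in s^2 - 1. *)
Lemma lower_bound_arith (x a b s eps : R) : 0 < x -> 0 <= a -> 0 < eps -> 0 <= s ->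
  1 <= eps * s -> b <= (3 + eps) * s -> x * a * b = s ^+ 2 - 1 ->
  (1 / 3 - eps) * (s / x) <= a.
Proof.
move=> x0 a0 eps0 s0 es bs E0; rewrite mulrA ler_pdivrMr //.
have s0' : 0 < s by rewrite lt0r s0 andbT; apply: contraTneq es => ->; rewrite mulr0 ler10.
have d0 : 0 < (3 + eps) * s by rewrite mulr_gt0 // addr_gt0.
rewrite -(ler_pM2r d0); apply: (@le_trans _ _ (s ^+ 2 - 1)); last first.
  by rewrite -E0 [a * x]mulrC; apply: ler_wpM2l bs; rewrite mulr_ge0 // ltW.
have e2 : 1 <= (eps * s) ^+ 2 by rewrite exprn_ege1.
have -> : (1 / 3 - eps) * s * ((3 + eps) * s) = s ^+ 2 - 8 / 3 * (eps * s) * s - (eps * s) ^+ 2.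
  by field.
rewrite lerB //.
have : 0 <= eps * s * s by rewrite !mulr_ge0 // ltW.
lra.
Qed.
End Arithmetic.

Lemma tile_first_bound (R : rcfType) (p k : nat) (s := Num.sqrt p%:R : R) :
  (2 <= k)%N -> prime p -> p = 1 %[mod k] ->
  (42 ^ 2 * k ^ 2 * (3 * k + 8) ^ 2 < p)%N ->
  forall A B : {set 'F_p}, sumset A B = kth_powers p k ->
  (2 <= #|A|)%N -> (2 <= #|B|)%N ->
  s <= 6 * k%:R * #|B|%:R /\ #|A|%:R <= 6 * s.
Proof.
move=> k2 p_pr pk pbig A B tile A2 B2.
have [E0 E1 E2] := tile_inequalities p_pr k2 pk tile A2 B2 R; rewrite -/s in E0 E1 E2.
have k2R : 2 <= k%:R :> R by rewrite ler_nat.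
have N2R : 2 <= #|A|%:R :> R by rewrite ler_nat.
have m2R : 2 <= #|B|%:R :> R by rewrite ler_nat.
have s2 : s ^+ 2 = p%:R by rewrite sqr_sqrtr ?ler0n.
have s0 : 0 <= s by apply: sqrtr_ge0.
clearbody s.
(* This is 42 k (3k + 8), more than the 90k^2 + 150k + 38 that excludes a small summand. *)
have sbig : 126 * k%:R ^+ 2 + 336 * k%:R <= s.
  have -> : 126 * k%:R ^+ 2 + 336 * k%:R = (42 * k * (3 * k + 8))%:R :> R.
    by rewrite !natrM natrD natrM; ring.
  rewrite -(@ler_pXn2r _ 2) ?nnegrE ?ler0n // s2 -natrX ler_nat ltnW //.
  by rewrite !expnMn.
have s10 : 10 <= s by nra.
suff main : #|A|%:R * s <= 6 * (s ^+ 2 - 1).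
  split.
    have N0 : 0 < #|A|%:R :> R by lra.
    by rewrite -(ler_pM2l N0); apply: le_trans main _; rewrite -E0; lra.
  have sp : 0 < s by lra.
  by rewrite -(ler_pM2r sp); apply: le_trans main _; nra.
have [mk|km] := leqP #|B| (6 * k + 1).
  exfalso; have p2 : (2 < p)%N by rewrite -(ltr_nat R) -s2; nra.
  have [[_ _ s33]|[D0 E3]] := E2 p2; first by clear -sbig k2R s33; nra.
  have [] := small_summand_arith k2 _ D0; first by rewrite B2.
  set D := (#|B|.-1 * _)%N in D0 E3 *; set G := (90 * k ^ 2 + _ + 30)%N.
  rewrite -!(ler_nat R) [(6 * D)%:R]natrM [(G * D)%:R]natrM => h1 h2.
  have DR : 0 < D%:R :> R by rewrite ltr0n.
  have : s ^+ 2 - 1 <= 6 + G%:R * s.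
    rewrite -(ler_pM2r DR); apply: (le_trans E3); rewrite mulrDl mulrAC.
    by rewrite lerD // ler_wpM2r.
  rewrite leNgt => /negP; apply; apply: quadratic_lt; rewrite ?ler0n //.
  rewrite /G 2!natrD [(90 * _)%:R]natrM [(150 * _)%:R]natrM natrX; have := sqr_ge0 (k%:R : R); clear -sbig k2R; lra.
have km' : 6 * k%:R + 2 <= #|B|%:R :> R.
  by rewrite -natrM -natrD ler_nat; apply: leq_trans km; rewrite addn2 addn1.
apply: (large_summand_arith k2R km' _ s10 E0 E1).
by clear -N2R; lra.
Qed.

Lemma tile_second_bound (R : rcfType) (k : nat) (eps : R) : (2 <= k)%N -> 0 < eps ->
  (forall x : R, exists n : nat, x <= n%:R) ->
  exists p0 : nat, forall p, prime p -> p = 1 %[mod k] -> (p0 < p)%N ->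
  1 <= eps * Num.sqrt p%:R /\
  forall A B : {set 'F_p}, sumset A B = kth_powers p k ->
  (2 <= #|A|)%N -> (2 <= #|B|)%N -> #|A|%:R <= (3 + eps) * Num.sqrt p%:R.
Proof.
move=> k2 eps0 archi.
(* For m >= [M0] this gives eps (m - 3k) >= 9k + 1, where 9k is the loss in (3 + eps)(m - 3k) = 3m +
   eps (m - 3k) - 9k. *)
have [M0 M0P] := archi ((9 * k%:R + 1) / eps + 3 * k%:R).
have [C epsC] := archi eps^-1.
(* [K1] and [K2] bound the coefficients of the mixed-moment inequality for all m <= [M0]; in [K],
   the term [C] ensures 1 <= eps sqrt p, and 40 exceeds the 33 of the case k = m = 2. *)
pose K1 := (M0 * M0.+1)%N; pose K2 := (k ^ 2 * M0 * (3 * M0 ^ 2 + M0 + 1))%N.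
pose K := (K1 + K2 + C + 40)%N.
exists (K ^ 2)%N => p p_pr pk pK.
have [s sE] : exists s : R, s = Num.sqrt p%:R by eexists.
have s2 : s ^+ 2 = p%:R by rewrite sE sqr_sqrtr ?ler0n.
have s0 : 0 <= s by rewrite sE sqrtr_ge0.
have Ks : K%:R <= s.
  by rewrite -(@ler_pXn2r _ 2) ?nnegrE ?ler0n // s2 -natrX ler_nat ltnW.
have KE : K%:R = K1%:R + K2%:R + C%:R + 40 :> R by rewrite !natrD.
have [K10 K20 C0] : [/\ 0 <= K1%:R :> R, 0 <= K2%:R :> R & 0 <= C%:R :> R].
  by rewrite !ler0n.
rewrite KE in Ks; rewrite -sE; split.
  have eC : 1 <= eps * C%:R by rewrite -ler_pdivrMl // mulr1.
  by apply: (le_trans eC); rewrite ler_pM2l //; lra.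
move=> A B tile A2 B2.
have [E0 E1 E2] := tile_inequalities p_pr k2 pk tile A2 B2 R.
rewrite -sE in E0 E1 E2.
have s40 : 40 <= s by lra.
have k2R : 2 <= k%:R :> R by rewrite ler_nat.
have m2R : 2 <= #|B|%:R :> R by rewrite ler_nat.
have [mM|Mm] := leqP #|B| M0.
  exfalso; have p2 : (2 < p)%N by rewrite -(ltr_nat R) -s2; clear -s40; nra.
  have [[_ _ s33]|[D0 E3]] := E2 p2; first by clear -s40 s33; lra.
  have := @quadratic_lt R s K1%:R K2%:R K10 K20; rewrite ltNge => /(_ _)/negP; apply.
    by clear -Ks C0; lra.
  have s21 : 0 <= s ^+ 2 - 1 by clear -s40; nra.
  apply: (@le_trans _ _ ((s ^+ 2 - 1) * (#|B|.-1 * (k.-1 * #|B| - 2))%:R)).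
    by rewrite ler_peMr // ler1n.
  apply: (le_trans E3); apply: lerD.
    by rewrite ler_nat leq_mul.
  apply: ler_wpM2r => //; rewrite ler_nat /K2 !leq_mul // leq_add2r leq_add //.
  by rewrite leq_mul2l leq_exp2r.
rewrite leNgt; apply/negP => NA.
have mM : M0%:R <= #|B|%:R :> R by rewrite ler_nat ltnW.
have gap : 1 <= eps * (#|B|%:R - 3 * k%:R) - 9 * k%:R.
  have := le_trans M0P mM; rewrite -lerBrDr ler_pdivrMr // => h; clear -h; lra.
have y3k : 0 < #|B|%:R - 3 * k%:R :> R.
  rewrite ltNge; apply/negP => /(mulr_ge0_le0 (ltW eps0)); clear -gap k2R; lra.
have sy : 80 <= s * #|B|%:R by clear -s40 m2R; nra.
have y0 : 0 < #|B|%:R * (#|B|%:R - 3 * k%:R) :> R by rewrite mulr_gt0 //; clear -m2R; lra.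
have : (3 + eps) * s * (#|B|%:R * (#|B|%:R - 3 * k%:R)) < 3 + 3 * #|B|%:R ^+ 2 * s.
  by apply: lt_le_trans E1; rewrite -[ltRHS]mulrA ltr_pM2r.
have -> : (3 + eps) * s * (#|B|%:R * (#|B|%:R - 3 * k%:R)) = 3 * #|B|%:R ^+ 2 * s
   + s * #|B|%:R * (eps * (#|B|%:R - 3 * k%:R) - 9 * k%:R) by ring.
rewrite addrC ltrD2r ltNge => /negP; apply.
have sy0 : 0 <= s * #|B|%:R by clear -sy; lra.
by apply: le_trans (ler_wpM2l sy0 gap); rewrite mulr1; clear -sy; lra.
Qed.

Theorem theorem1 (R : realType) (k : nat) (hk : (2 <= k)%N) :
  (forall p : nat, prime p -> p = 1 %[mod k] ->
     (42 ^ 2 * k ^ 2 * (3 * k + 8) ^ 2 < p)%N ->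
     forall A B : {set 'F_p},
       sumset A B = kth_powers p k -> (2 <= #|A|)%N -> (2 <= #|B|)%N ->
       (Num.sqrt p%:R / (6 * k%:R) <= #|A|%:R :> R /\
        #|A|%:R <= 6 * Num.sqrt p%:R :> R) /\
       (Num.sqrt p%:R / (6 * k%:R) <= #|B|%:R :> R /\
        #|B|%:R <= 6 * Num.sqrt p%:R :> R))
  /\
  (forall eps : R, 0 < eps ->
     exists p0 : nat, forall p : nat, prime p -> p = 1 %[mod k] ->
       (p0 < p)%N ->
       forall A B : {set 'F_p},
         sumset A B = kth_powers p k -> (2 <= #|A|)%N -> (2 <= #|B|)%N ->
         (#|A|%:R : R) \in `[(1 / 3 - eps) * (Num.sqrt p%:R / k%:R),
                             (3 + eps) * Num.sqrt p%:R] /\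
         (#|B|%:R : R) \in `[(1 / 3 - eps) * (Num.sqrt p%:R / k%:R),
                             (3 + eps) * Num.sqrt p%:R]).
Proof.
have k0 : 0 < k%:R :> R by rewrite ltr0n ltnW.
split=> [p p_pr pk pbig A B AB A2 B2|eps eps0].
  have [sB lA] := tile_first_bound R hk p_pr pk pbig AB A2 B2.
  rewrite sumsetC in AB.
  have [sA lB] := tile_first_bound R hk p_pr pk pbig AB B2 A2.
  have k6 : 0 < 6 * k%:R :> R by rewrite mulr_gt0.
  by rewrite !ler_pdivrMr // ![#|_|%:R * _]mulrC.
have archi (x : R) : exists n : nat, x <= n%:R.
  by exists (Num.bound `|x|); apply: le_trans (ler_norm x) (ltW (archi_boundP (normr_ge0 _))).
have [p0 p0P] := tile_second_bound hk eps0 archi.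
exists p0 => p p_pr pk pp0 A B AB A2 B2.
have [es bound] := p0P p p_pr pk pp0.
have lower (A' B' : {set 'F_p}) : sumset A' B' = kth_powers p k ->
    (2 <= #|A'|)%N -> (2 <= #|B'|)%N -> #|B'|%:R <= (3 + eps) * Num.sqrt p%:R ->
    (1 / 3 - eps) * (Num.sqrt p%:R / k%:R) <= #|A'|%:R.
  move=> A'B' A'2 B'2 hB.
  have [E0 _ _] := tile_inequalities p_pr hk pk A'B' A'2 B'2 R.
  exact: (lower_bound_arith k0 (ler0n _ _) eps0 (sqrtr_ge0 _) es hB E0).
have AB' : sumset B A = kth_powers p k by rewrite sumsetC.
have hA := bound A B AB A2 B2; have hB := bound B A AB' B2 A2.
by rewrite !in_itv /= hA hB (lower A B) // (lower B A).
Qed.
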